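(* Let $a,b,q,p$ be complex numbers with $a,b,q\neq 0$ and $|p|<1$, let $c,d,g,h$ be complex numbers, and let $n$ be a non-negative integer. Assume the parameters are chosen such that non-removable singularities and poles are avoided in the expressions below (so that both sides make sense, values at removable singularities being understood by continuity). Then \begin{align*} \sum_{k=0}^n&\Bigg(\frac{[2(gk+c)(hk+d)]_{a,b;q,p}\, [2ghk+ch+dg]_{aq^{2(gk-g+c)(hk+d)},\,bq^{(gk-g+c)(hk+d)};q,p}} {[2cd]_{a,b;q,p}\, [ch+dg]_{aq^{2(c-g)d},\,bq^{(c-g)d};q,p}}\\ &\times\prod_{j=0}^{k-1} \frac{[(gj+g+c)(hj+d)]_{aq^{2(gj-g+c)(hj+d)},\,bq^{(gj-g+c)(hj+d)};q,p}} {[(gj+g+c)(hj+d)]_{aq^{2(gj+g+c)(hj+2h+d)},\,bq^{(gj+g+c)(hj+2h+d)};q,p}}\\ &\times\prod_{j=0}^{k-1} W_{aq^{2(gj+c)(hj+h+d)},\,bq^{(gj+c)(hj+h+d)};q,p}(2ghj+2gh+ch+dg)^{-1}\Bigg)\\ ={}&\frac{[(gn+c)(hn+h+d)]_{a,b;q,p}\, [(g+c)d]_{aq^{2(c-g)d},\,bq^{(c-g)d};q,p}} {[2cd]_{a,b;q,p}\, [ch+dg]_{aq^{2(c-g)d},\,bq^{(c-g)d};q,p}}\\ &\times \prod_{j=1}^n\frac{[(gj+g+c)(hj+d)]_{aq^{2(gj-g+c)(hj+d)},\,bq^{(gj-g+c)(hj+d)};q,p}} {[(gj+c)(hj-h+d)]_{aq^{2(gj+c)(hj+h+d)},\,bq^{(gj+c)(hj+h+d)};q,p}}\\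 &\times\prod_{j=1}^n W_{aq^{2(gj-g+c)(hj+d)},\,bq^{(gj-g+c)(hj+d)};q,p}(2ghj+ch+dg)^{-1}\\ &-\frac{[(c-g)d]_{a,b;q,p}\, [c(d-h)]_{aq^{2c(h+d)},\,bq^{c(h+d)};q,p}} {[2cd]_{a,b;q,p}\, [ch+dg]_{aq^{2(c-g)d},\,bq^{(c-g)d};q,p}}\, W_{aq^{2(c-g)d},\,bq^{(c-g)d};q,p}(ch+dg). \end{align*}
   Context: For $|p|<1$ and complex $x\neq 0$, the modified Jacobi theta function is $\theta(x;p):=\prod_{j=0}^\infty (1-xp^j)(1-p^{j+1}/x)$, and $\theta(x_1,\dots,x_r;p):=\theta(x_1;p)\cdots\theta(x_r;p)$. (For $p=0$, $\theta(x;0)=1-x$.) Complex powers of $q$ are $q^z=e^{z\log q}$ for one fixed choice of $\log q$. For complex $z$ and nonzero $a,b$, the elliptic number is $$[z]_{a,b;q,p}:=\frac{\theta(q^z,aq^z,bq^2,a/b;p)}{\theta(q,aq,bq^{z+1},aq^{z-1}/b;p)}.$$ For complex $k$, the elliptic weight is $$W_{a,b;q,p}(k):=\frac{\theta(aq^{2k+1},bq,bq^2,aq^{-1}/b,a/b;p)}{\theta(aq,bq^{k+1},bq^{k+2},aq^{k-1}/b,aq^k/b;p)}\,q^k.$$ When subscripts such as $aq^{2x},bq^{x}$ appear, they replace $a,b$ in these definitions. $W_{\dots}(k)^{-1}$ denotes the reciprocal $1/W_{\dots}(k)$. Empty products equal $1$. *)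

(* Defs.v *)
From HB Require Import structures.
From mathcomp Require Import all_boot all_order all_algebra.
From mathcomp Require Import complex.
From mathcomp Require Import all_classical all_reals all_analysis.

Set Implicit Arguments.
Unset Strict Implicit.
Unset Printing Implicit Defensive.

Import Order.TTheory GRing.Theory Num.Theory.
Import numFieldNormedType.Exports.

Local Open Scope classical_set_scope.
Local Open Scope ring_scope.

(* The complex numbers over [R].  Bundling [R[i]] as a [numClosedFieldType]
   gives it the topology that MathComp-Analysis puts on every [numFieldType]. *)
Definition Cplx (R : realType) : numClosedFieldType := R[i]%C.

Section EllipticNumbers.
Variable R : realType.
Local Notation C := (Cplx R).

Definition cexp (z : C) : C :=
  Complex (expR (complex.Re z) * cos (complex.Im z))
          (expR (complex.Re z) * sin (complex.Im z)).

(* [logq] is the chosen logarithm of q, so q itself is [cexp logq]; the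
   functions below take [logq] where the usual notation has q. *)
Definition qpow (logq z : C) : C := cexp (z * logq).

(* Since [p ^+ 0 = 1] also for p = 0, this gives theta 0 x = 1 - x. *)
Definition theta (p x : C) : C :=
  lim ((fun N : nat =>
    \prod_(0 <= j < N) ((1 - x * p ^+ j) * (1 - p ^+ j.+1 / x))) @ \oo).

Definition thetas (p : C) (xs : seq C) : C := \prod_(x <- xs) theta p x.

Definition ell_num_den (logq p a b z : C) : C :=
  let q := cexp logq in
  thetas p [:: q; a * q; b * qpow logq (z + 1); a * qpow logq (z - 1) / b].

Definition ell_num (logq p a b z : C) : C :=
  let q := cexp logq in
  thetas p [:: qpow logq z; a * qpow logq z; b * q ^+ 2; a / b]
  / ell_num_den logq p a b z.

Definition ell_weight_den (logq p a b k : C) : C :=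
  let q := cexp logq in
  thetas p [:: a * q; b * qpow logq (k + 1); b * qpow logq (k + 2);
               a * qpow logq (k - 1) / b; a * qpow logq k / b].

Definition ell_weight (logq p a b k : C) : C :=
  let q := cexp logq in
  thetas p [:: a * qpow logq (2 * k + 1); b * q; b * q ^+ 2;
               a * q^-1 / b; a / b]
  / ell_weight_den logq p a b k * qpow logq k.

(* The same objects with subscripts a q^(2s), b q^s. *)
Definition ell_num_den_sh (logq p a b s z : C) : C :=
  ell_num_den logq p (a * qpow logq (2 * s)) (b * qpow logq s) z.
Definition ell_num_sh (logq p a b s z : C) : C :=
  ell_num logq p (a * qpow logq (2 * s)) (b * qpow logq s) z.
Definition ell_weight_den_sh (logq p a b s k : C) : C :=
  ell_weight_den logq p (a * qpow logq (2 * s)) (b * qpow logq s) k.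
Definition ell_weight_sh (logq p a b s k : C) : C :=
  ell_weight logq p (a * qpow logq (2 * s)) (b * qpow logq s) k.

(* A point (a, b, log q, c, d, g, h).  Singularities are removed by moving all
   seven coordinates at once, with p and n fixed; it is log q, not q, that
   moves, so that the powers q^z vary continuously. *)
Definition params : Type := (C * C * C * C * C * C * C)%type.

Definition lhs (p : C) (n : nat) (x : params) : C :=
  let: (a, b, logq, c, d, g, h) := x in
  let N0 := ell_num logq p a b in
  let N := ell_num_sh logq p a b in
  let W := ell_weight_sh logq p a b in
  \sum_(0 <= k < n.+1)
    ((N0 (2 * (g * k%:R + c) * (h * k%:R + d))
      * N ((g * k%:R - g + c) * (h * k%:R + d))
          (2 * g * h * k%:R + c * h + d * g))
     / (N0 (2 * c * d) * N ((c - g) * d) (c * h + d * g))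
     * (\prod_(0 <= j < k)
          (N ((g * j%:R - g + c) * (h * j%:R + d))
             ((g * j%:R + g + c) * (h * j%:R + d))
           / N ((g * j%:R + g + c) * (h * j%:R + 2 * h + d))
               ((g * j%:R + g + c) * (h * j%:R + d))))
     * (\prod_(0 <= j < k)
          (W ((g * j%:R + c) * (h * j%:R + h + d))
             (2 * g * h * j%:R + 2 * g * h + c * h + d * g))^-1)).

Definition rhs (p : C) (n : nat) (x : params) : C :=
  let: (a, b, logq, c, d, g, h) := x in
  let N0 := ell_num logq p a b in
  let N := ell_num_sh logq p a b in
  let W := ell_weight_sh logq p a b in
  (N0 ((g * n%:R + c) * (h * n%:R + h + d)) * N ((c - g) * d) ((g + c) * d))
  / (N0 (2 * c * d) * N ((c - g) * d) (c * h + d * g))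
  * (\prod_(1 <= j < n.+1)
       (N ((g * j%:R - g + c) * (h * j%:R + d))
          ((g * j%:R + g + c) * (h * j%:R + d))
        / N ((g * j%:R + c) * (h * j%:R + h + d))
            ((g * j%:R + c) * (h * j%:R - h + d))))
  * (\prod_(1 <= j < n.+1)
       (W ((g * j%:R - g + c) * (h * j%:R + d))
          (2 * g * h * j%:R + c * h + d * g))^-1)
  - (N0 ((c - g) * d) * N (c * (h + d)) (c * (d - h)))
    / (N0 (2 * c * d) * N ((c - g) * d) (c * h + d * g))
    * W ((c - g) * d) (c * h + d * g).

(* The points at which every denominator occurring in [lhs], at any nesting
   depth, is nonzero. *)
Definition lhs_regular (p : C) (n : nat) : set params := [set x : params |
  let: (a, b, logq, c, d, g, h) := x in
  let N0 := ell_num logq p a b in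
  let N := ell_num_sh logq p a b in
  let W := ell_weight_sh logq p a b in
  let N0den := ell_num_den logq p a b in
  let Nden := ell_num_den_sh logq p a b in
  let Wden := ell_weight_den_sh logq p a b in
  [/\ a != 0 /\ b != 0,
      N0den (2 * c * d) != 0 /\ N0 (2 * c * d) != 0,
      Nden ((c - g) * d) (c * h + d * g) != 0
        /\ N ((c - g) * d) (c * h + d * g) != 0,
      forall k : nat, (k <= n)%N ->
        N0den (2 * (g * k%:R + c) * (h * k%:R + d)) != 0
        /\ Nden ((g * k%:R - g + c) * (h * k%:R + d))
                (2 * g * h * k%:R + c * h + d * g) != 0
    & forall j : nat, (j < n)%N ->
        [/\ Nden ((g * j%:R - g + c) * (h * j%:R + d))
                 ((g * j%:R + g + c) * (h * j%:R + d)) != 0,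
            Nden ((g * j%:R + g + c) * (h * j%:R + 2 * h + d))
                 ((g * j%:R + g + c) * (h * j%:R + d)) != 0,
            N ((g * j%:R + g + c) * (h * j%:R + 2 * h + d))
              ((g * j%:R + g + c) * (h * j%:R + d)) != 0,
            Wden ((g * j%:R + c) * (h * j%:R + h + d))
                 (2 * g * h * j%:R + 2 * g * h + c * h + d * g) != 0
          & W ((g * j%:R + c) * (h * j%:R + h + d))
              (2 * g * h * j%:R + 2 * g * h + c * h + d * g) != 0]]].

(* Likewise for [rhs]. *)
Definition rhs_regular (p : C) (n : nat) : set params := [set x : params |
  let: (a, b, logq, c, d, g, h) := x in
  let N0 := ell_num logq p a b in
  let N := ell_num_sh logq p a b in
  let W := ell_weight_sh logq p a b in
  let N0den := ell_num_den logq p a b in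
  let Nden := ell_num_den_sh logq p a b in
  let Wden := ell_weight_den_sh logq p a b in
  [/\ [/\ a != 0, b != 0,
          N0den ((g * n%:R + c) * (h * n%:R + h + d)) != 0
        & Nden ((c - g) * d) ((g + c) * d) != 0],
      N0den (2 * c * d) != 0 /\ N0 (2 * c * d) != 0,
      Nden ((c - g) * d) (c * h + d * g) != 0
        /\ N ((c - g) * d) (c * h + d * g) != 0,
      [/\ N0den ((c - g) * d) != 0,
          Nden (c * (h + d)) (c * (d - h)) != 0
        & Wden ((c - g) * d) (c * h + d * g) != 0]
    & forall j : nat, (1 <= j <= n)%N ->
        [/\ Nden ((g * j%:R - g + c) * (h * j%:R + d))
                 ((g * j%:R + g + c) * (h * j%:R + d)) != 0,
            Nden ((g * j%:R + c) * (h * j%:R + h + d))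
                 ((g * j%:R + c) * (h * j%:R - h + d)) != 0,
            N ((g * j%:R + c) * (h * j%:R + h + d))
              ((g * j%:R + c) * (h * j%:R - h + d)) != 0,
            Wden ((g * j%:R - g + c) * (h * j%:R + d))
                 (2 * g * h * j%:R + c * h + d * g) != 0
          & W ((g * j%:R - g + c) * (h * j%:R + d))
              (2 * g * h * j%:R + c * h + d * g) != 0]]].

End EllipticNumbers.

Section RemovableSingularities.
Variables (R : realType) (T : topologicalType).

(* [f], given by an expression whose denominators do not vanish on [D], makes
   sense at [x]: either [x] is in [D], or [x] is a removable singularity,
   where the value is the limit of [f] at [x] along [D]. *)
Definition makes_sense_at (D : set T) (f : T -> Cplx R) (x : T) : Prop :=
  D x \/ closure D x /\ cvg (f @ within D (nbhs x)).

Definition value_at (D : set T) (f : T -> Cplx R) (x : T) : Cplx R :=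
  if `[< D x >] then f x else lim (f @ within D (nbhs x)).

End RemovableSingularities.

(* Main.v *)
Require Import Defs.
From mathcomp Require Import all_boot all_order all_algebra.
From mathcomp Require Import complex.
From mathcomp Require Import all_classical all_reals all_analysis.
From mathcomp Require Import ring lra zify.
Import Order.TTheory GRing.Theory Num.Theory.
Import numFieldNormedType.Exports.
Local Open Scope ring_scope.

(** With s_k = (gk+c)(hk+h+d), the k-th summand numerator splits, by the
    Weierstrass addition formula for theta, into a difference whose two halves
    cancel between consecutive k; a denominator that this splitting introduces
    for an intermediate k is already nonzero because its theta factors occur
    in neighbouring denominators.

    The addition formula follows from the finite Jacobi triple product: after
    the change of variables (m, n) |-> (m + n, m - n), Tannery's theorem writes
    theta(xy) theta(x/y) as the limit of x (B(x) A(y) - A(x) B(y)), and the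
    formula becomes the Pluecker relation for 2 x 2 minors.

    At a removable singularity both sides are limits along their own sets of
    regular points, so these two sets must have common points arbitrarily
    near.  In logarithmic coordinates each theta factor is theta(exp P(t)) along
    a line, with P a polynomial, and it vanishes identically or for countably
    many real t only; hence a nonempty set of regular points is dense. *)

Set Implicit Arguments.
Unset Strict Implicit.
Unset Printing Implicit Defensive.
Local Open Scope classical_set_scope.
Local Open Scope ring_scope.

(** * Complex norm and exponential *)

(** Two obstacles shape the proof. The first is the addition formula, whose classical proof counts
    zeros of quasi-periodic holomorphic functions. Here no function theory enters: the relation
    between minors is an algebraic identity at every finite N, and only the products theta(xy)
    theta(x/y) pass to the limit. The rotation of the lattice does not preserve square truncations,
    and the finite triple product carries coefficients that are constant only in the limit; a
    domination argument absorbs both discrepancies at once. The second is that the two sides have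
    different sets of regular points. The left set is open, and the right set is dense near points
    with a, b nonzero once it is nonempty, which together give common points. Density does not use
    isolated zeros of analytic functions: the zeros of theta are known explicitly, so each condition
    fails on a countable set of real t, and finitely many such conditions combine because
    cocountable sets form a filter. The same persistence argument, with neighbourhoods in place of
    cocountable sets, gives openness. *)

Lemma cvg_dist_le (R : realType) (T : Type) (F : set_system T) {FF : Filter F}
    (f : T -> R) (l : R) (e : T -> R) :
  (forall t, `|f t - l| <= e t) -> e @ F --> 0 -> f @ F --> l.
Proof.
move=> fle e0; apply/subr_cvg0/norm_cvg0P; apply: (squeeze_cvgr _ (cvg_cst _) e0).
by apply: nearW => t; rewrite normr_ge0 /=.
Qed.

Section RealNorm.
Variable R : realType.
Local Notation C := (Cplx R).
Local Notation Re := complex.Re.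
Local Notation Im := complex.Im.
Implicit Types z w : C.

(** The norm of [C] takes its values in [C] itself; this copy with values in [R] gives access to
    real estimates, suprema and monotone limits. *)
Definition nrm (z : C) : R := ComplexField.Normc.normc z.

Lemma normE z : `|z| = (nrm z)%:C%C :> C.
Proof. by []. Qed.

Lemma nrm_ge0 z : 0 <= nrm z.
Proof. by case: z => x y; exact: sqrtr_ge0. Qed.

Lemma nrmM z w : nrm (z * w) = nrm z * nrm w.
Proof. exact: ComplexField.Normc.normcM. Qed.

Lemma nrmV z : nrm z^-1 = (nrm z)^-1.
Proof. exact: ComplexField.Normc.normcV. Qed.

Lemma nrm0 : nrm 0 = 0.
Proof. exact: ComplexField.Normc.normc0. Qed.

Lemma nrm1 : nrm 1 = 1.
Proof. exact: ComplexField.Normc.normc1. Qed.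

Lemma nrmD z w : nrm (z + w) <= nrm z + nrm w.
Proof. exact: le_normcD. Qed.

Lemma nrmN z : nrm (- z) = nrm z.
Proof. exact: normcN. Qed.

Lemma nrmB z w : nrm (z - w) <= nrm z + nrm w.
Proof. by rewrite -(nrmN w) nrmD. Qed.

Lemma nrm_dist z w : nrm (z - w) = nrm (w - z).
Proof. by rewrite -nrmN opprB. Qed.

Lemma nrm_eq0 z : (nrm z == 0) = (z == 0).
Proof.
apply/eqP/eqP => [|->]; last exact: nrm0.
exact: ComplexField.Normc.eq0_normc.
Qed.

Lemma nrm_gt0 z : (0 < nrm z) = (z != 0).
Proof. by rewrite lt_def nrm_ge0 nrm_eq0 andbT. Qed.

Lemma nrmX z n : nrm (z ^+ n) = nrm z ^+ n.
Proof. by elim: n => [|n IH]; rewrite ?expr0 ?nrm1// !exprS nrmM IH. Qed.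

Lemma nrm_exprz z (n : int) : nrm (z ^ n) = nrm z ^ n.
Proof. by case: n => n; rewrite ?NegzE -?exprnN -?exprnP ?nrmV nrmX. Qed.

Lemma nrm_sum I (r : seq I) (P : pred I) (F : I -> C) :
  nrm (\sum_(i <- r | P i) F i) <= \sum_(i <- r | P i) nrm (F i).
Proof.
elim/big_ind2 : _ => //; first by rewrite nrm0.
by move=> x1 x2 y1 y2 h1 h2; rewrite (le_trans (nrmD _ _))// lerD.
Qed.

Lemma nrm_ge_Re z : `|Re z| <= nrm z.
Proof.
case: z => x y /=; rewrite -sqrtr_sqr ler_sqrt ?lerDl ?sqr_ge0//.
by rewrite addr_ge0 ?sqr_ge0.
Qed.

Lemma nrm_ge_Im z : `|Im z| <= nrm z.
Proof.
case: z => x y /=; rewrite -sqrtr_sqr ler_sqrt ?lerDr ?sqr_ge0//.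
by rewrite addr_ge0 ?sqr_ge0.
Qed.

Lemma nrm_le_ReIm z : nrm z <= `|Re z| + `|Im z|.
Proof.
case: z => x y /=; rewrite -[leRHS]ger0_norm ?addr_ge0// -sqrtr_sqr.
rewrite ler_sqrt ?sqr_ge0// sqrrD !real_normK ?num_real//.
by rewrite lerD2r lerDl mulrn_wge0// mulr_ge0.
Qed.

Lemma cvg_nrmP (T : Type) (F : set_system T) {FF : Filter F} (f : T -> C) (l : C) :
  f @ F --> l <-> nrm (f t - l) @[t --> F] --> (0 : R).
Proof.
split=> [/cvgrPdist_lt h|/cvgrPdist_lt h]; apply/cvgrPdist_lt => e e0.
  have := h e%:C%C; rewrite ltcR => /(_ e0); apply: filterS => t.
  by rewrite normE ltcR sub0r normrN ger0_norm ?nrm_ge0// nrm_dist.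
(* In the order on [C], [0 < e] forces e to be real, so complex radii are no more general than real
   ones. *)
case: e e0 => e e'; rewrite ltcE/= => /andP[/eqP e'0 e0].
have := h e e0; apply: filterS => t.
rewrite sub0r normrN ger0_norm ?nrm_ge0// => he.
by rewrite normE ltcE/= e'0 eqxx nrm_dist.
Qed.

Lemma cvg_ReIm (T : Type) (F : set_system T) {FF : Filter F} (f : T -> C) (l : C) :
  Re (f t) @[t --> F] --> Re l -> Im (f t) @[t --> F] --> Im l -> f @ F --> l.
Proof.
move=> hr hi; apply/cvg_nrmP.
apply: (@cvg_dist_le _ _ _ _ _ _ (fun t => `|Re (f t) - Re l| + `|Im (f t) - Im l|)).
  move=> t; rewrite subr0 ger0_norm ?nrm_ge0//.
  by apply: le_trans (nrm_le_ReIm _) _; case: (f t) => ? ?; case: (l).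
by rewrite -(addr0 (0:R)); apply: cvgD; apply/norm_cvg0P; exact/subr_cvg0.
Qed.

Lemma cvg_Re (T : Type) (F : set_system T) {FF : Filter F} (f : T -> C) (l : C) :
  f @ F --> l -> Re (f t) @[t --> F] --> Re l.
Proof.
move=> /cvg_nrmP; apply: cvg_dist_le => t.
by have := nrm_ge_Re (f t - l); case: (f t) => ? ?; case: (l).
Qed.

Lemma cvg_Im (T : Type) (F : set_system T) {FF : Filter F} (f : T -> C) (l : C) :
  f @ F --> l -> Im (f t) @[t --> F] --> Im l.
Proof.
move=> /cvg_nrmP; apply: cvg_dist_le => t.
by have := nrm_ge_Im (f t - l); case: (f t) => ? ?; case: (l).
Qed.

Lemma cvg_nrm (T : Type) (F : set_system T) {FF : Filter F} (f : T -> C) (l : C) :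
  f @ F --> l -> nrm (f t) @[t --> F] --> nrm l.
Proof.
move=> /cvg_nrmP; apply: cvg_dist_le => t; rewrite ler_norml.
have := nrmD (f t - l) l; have := nrmD (l - f t) (f t).
by rewrite !subrK (nrm_dist l) => h1 h2; apply/andP; split; lra.
Qed.

End RealNorm.

Section Cexp.
Variable R : realType.
Local Notation C := (Cplx R).
Local Notation Re := complex.Re.
Local Notation Im := complex.Im.
Implicit Types z w : C.

Lemma cexpD z w : cexp (z + w) = cexp z * cexp w.
Proof.
case: z w => [a b] [c d]; apply/eqP; rewrite eq_complex/= expRD cosD sinD.
by apply/andP; split; apply/eqP; ring.
Qed.

Lemma cexp0 : cexp 0 = 1 :> C.
Proof. by rewrite /cexp/= expR0 cos0 sin0 mulr0 mulr1. Qed.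

Lemma cexp_neq0 z : cexp z != 0.
Proof.
apply/eqP => h; have := cexp0; rewrite -(subrr z) cexpD h mul0r => /eqP.
by rewrite eq_sym oner_eq0.
Qed.

Lemma cexpN z : cexp (- z) = (cexp z)^-1.
Proof.
apply: (mulIf (cexp_neq0 z)); rewrite -cexpD addNr cexp0 mulVf//.
exact: cexp_neq0.
Qed.

Lemma cvg_cexp (T : Type) (F : set_system T) {FF : Filter F} (f : T -> C) (l : C) :
  f @ F --> l -> cexp (f t) @[t --> F] --> cexp l.
Proof.
move=> fl.
have hr : Re (f t) @[t --> F] --> Re l by exact: cvg_Re fl.
have hi : Im (f t) @[t --> F] --> Im l by exact: cvg_Im fl.
have he : expR (Re (f t)) @[t --> F] --> expR (Re l).
  by apply: continuous_cvg hr; exact: continuous_expR.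
have hc : cos (Im (f t)) @[t --> F] --> cos (Im l).
  by apply: continuous_cvg hi; exact: continuous_cos.
have hs : sin (Im (f t)) @[t --> F] --> sin (Im l).
  by apply: continuous_cvg hi; exact: continuous_sin.
by apply: cvg_ReIm; apply: cvgM.
Qed.

(** Polar form. The angle is [acos (x / m)] up to sign, and the sign follows that of y because
    [acos] only reaches the upper half plane. *)
Lemma cexp_surj z : z != 0 -> exists w, cexp w = z.
Proof.
case: z => x y z0; set m := nrm (Complex x y : C).
have m0 : 0 < m by rewrite nrm_gt0.
have mE : m ^+ 2 = x ^+ 2 + y ^+ 2.
  by rewrite /m /= sqr_sqrtr// addr_ge0 ?sqr_ge0.
have x1 : -1 <= x / m <= 1.
  rewrite ler_pdivlMr// ler_pdivrMr// mul1r mulN1r -ler_norml.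
  exact: (nrm_ge_Re (Complex x y)).
have hs : sin (acos (x / m)) = `|y| / m.
  have <- : Num.sqrt ((`|y| / m) ^+ 2) = `|y| / m.
    by rewrite sqrtr_sqr ger0_norm// divr_ge0// ltW.
  rewrite sin_acos//; congr Num.sqrt; rewrite !expr_div_n real_normK ?num_real//.
  by rewrite mE; field; rewrite -mE expf_neq0// gt_eqF.
have hc : cos (acos (x / m)) = x / m by rewrite acosK// in_itv.
have [y0|y0] := leP 0 y.
  exists (Complex (ln m) (acos (x / m))).
  rewrite /cexp/= hs hc lnK ?posrE// ger0_norm//.
  by congr Complex; field; rewrite gt_eqF.
exists (Complex (ln m) (- acos (x / m))).
rewrite /cexp/= sinN cosN hs hc lnK ?posrE// ltr0_norm//.
by congr Complex; field; rewrite gt_eqF.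
Qed.

Definition cpi2 : C := Complex 0 (pi *+ 2).

Lemma cexp_eq1 z : cexp z = 1 -> exists m : int, z = cpi2 *~ m.
Proof.
case: z => x y [hc hs].
have x0 : x = 0.
  have : expR x ^+ 2 = 1.
    rewrite -[RHS](expr1n _ 2) -[in RHS]hc -[LHS]mulr1 -(cos2Dsin2 y).
    by rewrite mulrDr -!exprMn hs expr0n addr0.
  rewrite -expR0 -expRM_natl => /expR_inj/eqP.
  by rewrite mulf_eq0 pnatr_eq0/= => /eqP.
have {hs}cy : cos y = 1 by rewrite -hc x0 expR0 mul1r.
have p2 : 0 < (pi *+ 2 : R) by rewrite mulrn_wgt0 ?pi_gt0.
pose m := Num.floor (y / (pi *+ 2)); exists m.
have cosP (u : R) (k : int) : cos (u + pi *+ 2 *~ k) = cos u.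
  case: k => k; first exact: periodicn (@cosD2pi R) k u.
  by rewrite NegzE mulrNz -pmulrn -[LHS](periodicn (@cosD2pi R) k.+1) subrK.
(* v is the representative of y in [0, 2 pi). As cos is injective on [0, pi], a v beyond pi is
   treated through its reflection 2 pi - v. *)
pose v := y - pi *+ 2 *~ m.
have cv : cos v = 1 by rewrite /v -mulrNz cosP.
have v0 : 0 <= v.
  by rewrite subr_ge0 -mulrzl -ler_pdivlMr// floor_le.
have v2 : v < pi *+ 2.
  rewrite ltrBlDr -[X in X + _]mulr1z -mulrzDr -mulrzl -ltr_pdivrMr// addrC.
  exact: floorD1_gt.
have vE : v = 0.
  have [vp|vp] := leP v pi.
    by apply: (@cos_inj R); rewrite ?in_itv/= ?lexx ?pi_ge0 ?v0 ?cos0.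
  have : pi *+ 2 - v = 0.
    apply: (@cos_inj R); rewrite ?in_itv/= ?lexx ?pi_ge0 ?cos0//.
      by rewrite subr_ge0 (ltW v2)/= lerBlDr mulr2n lerD2l ltW.
    by rewrite addrC cosD2pi cosN.
  by move/eqP; rewrite subr_eq0 => /eqP h; move: v2; rewrite -h ltxx.
have -> : y = pi *+ 2 *~ m by apply/eqP; rewrite -subr_eq0 -/v vE.
rewrite x0; have im k (u : R) : Complex 0 u *+ k = Complex 0 (u *+ k) :> C.
  elim: k => [//|k IH]; rewrite !mulrS IH.
  by apply/eqP; rewrite eq_complex/= addr0 !eqxx.
case: (m) => k; first by rewrite -!pmulrn im.
by rewrite NegzE !mulrNz -!pmulrn im; apply/eqP; rewrite eq_complex/= oppr0 !eqxx.
Qed.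

End Cexp.

(** * Products with geometrically decaying factors *)

Section GeometricProduct.
Variables (R : realType) (r : R).
Hypotheses (r_ge0 : 0 <= r) (r_lt1 : r < 1).
Local Notation C := (Cplx R).

Let r1_gt0 : 0 < 1 - r. Proof. by rewrite subr_gt0. Qed.

Lemma cvg_geo (K : R) : K * r ^+ n @[n --> \oo] --> 0.
Proof.
by apply: (@cvg_geometric R K r); rewrite ger0_norm.
Qed.

Lemma geo_sum_le (B : R) m n : 0 <= B ->
  \sum_(m <= j < n) B * r ^+ j <= B * r ^+ m / (1 - r).
Proof.
move=> B0; have [nm|mn] := leqP n m.
  by rewrite big_geq// divr_ge0 ?mulr_ge0 ?exprn_ge0// ltW.
rewrite ler_pdivlMr//; apply: (@le_trans _ _ (B * (r ^+ m - r ^+ n))).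
  have /= tel := telescope_sumr (fun j => B * r ^+ j) (ltnW mn).
  rewrite mulr_suml mulrBr -[leRHS]opprB -tel.
  rewrite -sumrN le_eqVlt; apply/orP; left; apply/eqP; apply: eq_bigr => j _.
  by rewrite exprS; ring.
by rewrite ler_wpM2l// gerBl exprn_ge0.
Qed.

Lemma geo_cvgR (w : nat -> R) (K : R) :
  (forall n, `|w n.+1 - w n| <= K * r ^+ n) -> exists l : R, w @ \oo --> l.
Proof.
move=> hw; have K0 : 0 <= K by have := hw 0%N; rewrite expr0 mulr1; apply: le_trans.
(* Subtracting the geometric tail that bounds all later increments makes the sequence nondecreasing,
   so monotone convergence applies. *)
pose z n := w n - K * r ^+ n / (1 - r).
have zw n : w n = z n + K / (1 - r) * r ^+ n by rewrite /z; ring.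
have zn : nondecreasing_seq z.
  apply/nondecreasing_seqP => n; have := hw n; rewrite ler_norml => /andP[h _].
  rewrite -subr_ge0 /z exprS.
  have -> : w n.+1 - K * (r * r ^+ n) / (1 - r) - (w n - K * r ^+ n / (1 - r)) =
     w n.+1 - w n + K * r ^+ n by field; rewrite gt_eqF.
  by lra.
have /(nondecreasing_is_cvgn zn)/cvg_ex[/= l zl] : has_ubound (range z).
  exists (w 0%N + K / (1 - r)) => _ [n _ <-].
  apply: (@le_trans _ _ (w n)).
    by rewrite zw lerDl mulr_ge0 ?divr_ge0 ?exprn_ge0// ltW.
  have -> : w n = w 0%N + \sum_(0 <= j < n) (w j.+1 - w j).
    by rewrite telescope_sumr//; ring.
  rewrite lerD2l; have := geo_sum_le 0 n K0; rewrite expr0 mulr1; apply: le_trans.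
  apply: ler_sum_nat => j _.
  by apply: le_trans (hw j); rewrite ler_norm.
exists l; rewrite -(addr0 l) (_ : w = fun n => z n + K / (1 - r) * r ^+ n).
  by apply: cvgD => //; exact: cvg_geo.
by apply/funext => n.
Qed.

(** The rate depends on w only through K; this uniformity later yields the continuity of theta. *)
Lemma geo_cvg (w : nat -> C) (K : R) :
  (forall n, nrm (w n.+1 - w n) <= K * r ^+ n) ->
  exists2 l : C, w @ \oo --> l & forall n, nrm (w n - l) <= K / (1 - r) * r ^+ n.
Proof.
move=> hw; have K0 : 0 <= K.
  by have := hw 0%N; rewrite expr0 mulr1; apply: le_trans; exact: nrm_ge0.
have [|a ha] := @geo_cvgR (fun n => complex.Re (w n)) K.
  move=> n; apply: le_trans (hw n); have := nrm_ge_Re (w n.+1 - w n).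
  by case: (w n.+1) (w n) => ? ? [].
have [|b hb] := @geo_cvgR (fun n => complex.Im (w n)) K.
  move=> n; apply: le_trans (hw n); have := nrm_ge_Im (w n.+1 - w n).
  by case: (w n.+1) (w n) => ? ? [].
have wl : w @ \oo --> (Complex a b : C) by exact: cvg_ReIm.
exists (Complex a b) => // n.
have hd : nrm (w n - w m) @[m --> \oo] --> nrm (w n - Complex a b).
  by apply: cvg_nrm; apply: cvgB; [exact: cvg_cst|exact: wl].
apply: (cvgr_to_le hd); near=> m.
have nm : (n <= m)%N by near: m; exact: nbhs_infty_ge.
have -> : w n - w m = - \sum_(n <= j < m) (w j.+1 - w j).
  by rewrite telescope_sumr// opprB.
rewrite nrmN mulrAC; apply: le_trans (geo_sum_le n m K0).
by apply: le_trans (nrm_sum _ _ _) _; apply: ler_sum_nat.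
Unshelve. all: by end_near. Qed.

Variables (u : nat -> C) (B : R).
Hypothesis (uB : forall j, nrm (u j) <= B * r ^+ j).

Let B_ge0 : 0 <= B.
Proof. by have := uB 0; rewrite expr0 mulr1; apply: le_trans; exact: nrm_ge0. Qed.

Lemma nrm_prodD1_le n :
  nrm (\prod_(0 <= j < n) (1 + u j)) <= expR (B / (1 - r)).
Proof.
apply: (@le_trans _ _ (expR (\sum_(0 <= j < n) B * r ^+ j))).
  elim: n => [|n IH]; first by rewrite !big_geq// nrm1 expR0.
  rewrite !big_nat_recr//= nrmM expRD ler_pM ?nrm_ge0//.
  apply: le_trans (nrmD _ _) _; rewrite nrm1; apply: le_trans (expR_ge1Dx _).
  by rewrite lerD2l.
rewrite ler_expR; apply: le_trans (geo_sum_le 0 n B_ge0) _.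
by rewrite expr0 mulr1.
Qed.

Lemma cvg_prodD1 : exists2 l : C,
  \prod_(0 <= j < n) (1 + u j) @[n --> \oo] --> l &
  forall n, nrm (\prod_(0 <= j < n) (1 + u j) - l)
            <= expR (B / (1 - r)) * B / (1 - r) * r ^+ n.
Proof.
apply: geo_cvg => n; rewrite big_nat_recr//= mulrDr mulr1 addrAC subrr add0r nrmM.
by rewrite -mulrA ler_pM ?nrm_ge0// nrm_prodD1_le.
Qed.

(** Weierstrass's inequality: a product of |1 + u j| is at least 1 minus the sum of the |u j|. The
    hypothesis keeps all partial sums at most 1, so the lower bounds multiplied in the induction
    stay nonnegative. *)
Lemma nrm_prodD1_ge m n : B * r ^+ m / (1 - r) <= 1 ->
  1 - B * r ^+ m / (1 - r) <= nrm (\prod_(m <= j < n) (1 + u j)).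
Proof.
move=> h1; have hs k : \sum_(m <= j < k) nrm (u j) <= B * r ^+ m / (1 - r).
  by apply: le_trans (geo_sum_le m k B_ge0); apply: ler_sum_nat.
suff H k : 1 - \sum_(m <= j < k) nrm (u j) <= nrm (\prod_(m <= j < k) (1 + u j)).
  by apply: le_trans (H n); rewrite lerD2l lerN2.
elim: k => [|k IH]; first by rewrite !big_geq// nrm1 subr0.
have [mk|km] := leqP m k; last by rewrite !big_geq// nrm1 subr0.
rewrite !big_nat_recr//= nrmM.
have h2 : 1 - nrm (u k) <= nrm (1 + u k).
  by have := nrmB (1 + u k) (u k); rewrite addrK nrm1 => h; lra.
have h3 := nrm_ge0 (\prod_(m <= i < k) (1 + u i)).
have h4 := hs k; have h5 := nrm_ge0 (u k).
have h6 : 0 <= \sum_(m <= i < k) nrm (u i) by apply: sumr_ge0 => *; exact: nrm_ge0.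
have h7 : 1 - \sum_(m <= i < k.+1) nrm (u i) >= 0 by have := hs k.+1; lra.
move: h7; rewrite big_nat_recr//= => h7.
nra.
Qed.

(** The head up to m is a finite product of nonzero factors. With m chosen so that the tail sum is
    below 1/2, every longer product keeps at least half the norm of the head. *)
Lemma lim_prodD1_neq0 (l : C) : \prod_(0 <= j < n) (1 + u j) @[n --> \oo] --> l ->
  (forall j, 1 + u j != 0) -> l != 0.
Proof.
move=> hl hu.
have : \forall m \near \oo, B / (1 - r) * r ^+ m < 2^-1.
  by apply: (cvgr_lt _ (cvg_geo (B / (1 - r)))); rewrite invr_gt0.
move=> [m _ /(_ m (leqnn _)) /=] hm.
pose P := \prod_(0 <= j < m) (1 + u j).
have P0 : P != 0 by rewrite prodf_seq_neq0; apply/allP => j _; rewrite hu.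
rewrite -nrm_gt0; apply: (@lt_le_trans _ _ (nrm P / 2)).
  by rewrite divr_gt0 ?nrm_gt0.
apply: (cvgr_to_ge (cvg_nrm hl)); near=> n.
have mn : (m <= n)%N by near: n; exact: nbhs_infty_ge.
rewrite (@big_cat_nat _ _ _ m)//= nrmM ler_wpM2l ?nrm_ge0//.
have h : B * r ^+ m / (1 - r) < 2^-1 by rewrite mulrAC.
by apply: le_trans (nrm_prodD1_ge n _); lra.
Unshelve. all: by end_near. Qed.

End GeometricProduct.

(** * The theta function *)

Section Theta.
Variables (R : realType).
Local Notation C := (Cplx R).
Variables (p : C).
Hypothesis hp : nrm p < 1.

Definition theta_part (N : nat) (x : C) : C :=
  \prod_(0 <= j < N) ((1 - x * p ^+ j) * (1 - p ^+ j.+1 / x)).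

Lemma theta_part0 x : theta_part 0 x = 1.
Proof. exact: big_geq. Qed.

Lemma theta_partS N x : theta_part N.+1 x =
  theta_part N x * ((1 - x * p ^+ N) * (1 - p ^+ N.+1 / x)).
Proof. by rewrite /theta_part big_nat_recr. Qed.

(* The j-th factor is [1 + u x j], of size at most [rho x * nrm p ^+ j]. *)
Let rho (x : C) := nrm x + nrm x^-1 + nrm x * nrm x^-1.
Let u (x : C) j : C := - (x * p ^+ j) - p ^+ j.+1 / x + x * p ^+ j * (p ^+ j.+1 / x).

Let uE x j : (1 - x * p ^+ j) * (1 - p ^+ j.+1 / x) = 1 + u x j.
Proof. by rewrite /u; ring. Qed.

Let r_ge0 : 0 <= nrm p. Proof. exact: nrm_ge0. Qed.

(** B is any bound of [rho x], so that one constant serves all x near a given point. *)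
Let u_le x (B : R) j : rho x <= B -> nrm (u x j) <= B * nrm p ^+ j.
Proof.
move=> xB; apply: (@le_trans _ _ (rho x * nrm p ^+ j)); last first.
  by rewrite ler_wpM2r// exprn_ge0.
rewrite /u /rho; apply: le_trans (nrmD _ _) _; rewrite mulrDl; apply: lerD; last first.
  rewrite !nrmM !nrmX exprS.
  have h0 : 0 <= nrm p ^+ j <= 1 by rewrite exprn_ge0//= exprn_ile1// ltW.
  have -> : nrm x * nrm p ^+ j * (nrm p * nrm p ^+ j * nrm x^-1) =
    nrm x * nrm x^-1 * nrm p ^+ j * (nrm p * nrm p ^+ j) by ring.
  case/andP: h0 => h0 h1.
  rewrite ler_piMr ?mulr_ge0 ?nrm_ge0//.
  by rewrite mulr_ile1// ltW.
apply: le_trans (nrmB _ _) _; rewrite mulrDl nrmN !nrmM !nrmX exprS lerD2l.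
rewrite mulrAC ler_wpM2r ?exprn_ge0// -[leRHS]mul1r ler_wpM2r ?nrm_ge0//.
exact: ltW.
Qed.

Let K (B : R) := expR (B / (1 - nrm p)) * B / (1 - nrm p).

Let theta_part_cvg_rate x (B : R) : rho x <= B ->
  theta_part N x @[N --> \oo] --> theta p x /\
  forall N, nrm (theta_part N x - theta p x) <= K B * nrm p ^+ N.
Proof.
move=> xB; have [l hl hd] := @cvg_prodD1 R (nrm p) r_ge0 hp (u x) B (fun j => u_le j xB).
have E : (fun N => theta_part N x) = (fun N => \prod_(0 <= j < N) (1 + u x j)).
  by apply/funext => N; apply: eq_bigr => j _; exact: uE.
have hl' : theta_part N x @[N --> \oo] --> l by rewrite E.
have -> : theta p x = l by apply: cvg_lim hl'; exact: norm_hausdorff.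
by split=> // N; have := hd N; rewrite -/(K B) (congr1 (fun f => f N) E).
Qed.

Lemma cvg_theta_part x : theta_part N x @[N --> \oo] --> theta p x.
Proof. by have [] := theta_part_cvg_rate (lexx (rho x)). Qed.

Lemma theta_neq0 x : x != 0 -> (forall j, x * p ^+ j != 1) ->
  (forall j, p ^+ j.+1 / x != 1) -> theta p x != 0.
Proof.
move=> x0 h1 h2.
apply: (@lim_prodD1_neq0 R (nrm p) r_ge0 hp (u x) (rho x) (fun j => u_le j (lexx _))).
  rewrite [X in X @ _](_ : _ = fun N => theta_part N x); first exact: cvg_theta_part.
  by apply/funext => N; apply: eq_bigr => j _; rewrite -uE.
by move=> j; rewrite -uE mulf_neq0// subr_eq0 eq_sym.
Qed.

(** Locally uniform limit of continuous functions: [rho (f t)] is eventually below [rho l + 1], and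
    this single bound controls the distance to the partial products at both points. *)
Lemma cvg_theta (T : Type) (F : set_system T) {FF : Filter F} (f : T -> C) (l : C) :
  l != 0 -> f @ F --> l -> theta p (f t) @[t --> F] --> theta p l.
Proof.
move=> l0 fl; apply/cvg_nrmP/cvgr0Pnorm_lt => e e0.
have rl : rho (f t) @[t --> F] --> rho l.
  have h : (f t)^-1 @[t --> F] --> l^-1 by exact: (cvgV l0 fl).
  have h1 := @cvg_nrm _ _ _ FF _ _ fl; have h2 := @cvg_nrm _ _ _ FF _ _ h.
  by apply: cvgD; [apply: cvgD|apply: cvgM].
have hB : \forall t \near F, rho (f t) <= rho l + 1.
  by apply: (cvgr_le _ rl); rewrite ltrDl.
have : \forall N \near \oo, K (rho l + 1) * nrm p ^+ N < e / 3.
  by apply: (cvgr_lt _ (cvg_geo r_ge0 hp _)); rewrite divr_gt0.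
move=> [N _ /(_ N (leqnn _)) /=] hN.
have Tl : theta_part N (f t) @[t --> F] --> theta_part N l.
  elim: N {hN} => [|N IH].
    by under eq_fun do rewrite theta_part0; rewrite theta_part0; exact: cvg_cst.
  under eq_fun do rewrite theta_partS; rewrite theta_partS.
  apply: cvgM; first exact: IH.
  apply: cvgM; apply: cvgB.
  - exact: cvg_cst.
  - by apply: cvgM; [exact: fl|exact: cvg_cst].
  - exact: cvg_cst.
  - by apply: cvgM; [exact: cvg_cst|exact: (cvgV l0 fl)].
have hT : \forall t \near F, nrm (theta_part N (f t) - theta_part N l) < e / 3.
  by move/cvg_nrmP : Tl => Tl; apply: (cvgr_lt _ Tl); rewrite divr_gt0.
have [_ /(_ N) hl] := @theta_part_cvg_rate l (rho l + 1) ltac:(by rewrite lerDl).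
apply: filterS2 hB hT => t hB hT.
have [_ /(_ N) ht] := theta_part_cvg_rate hB.
rewrite ger0_norm ?nrm_ge0//.
have -> : theta p (f t) - theta p l = - (theta_part N (f t) - theta p (f t)) +
   ((theta_part N (f t) - theta_part N l) + (theta_part N l - theta p l)) by ring.
have := nrmD (- (theta_part N (f t) - theta p (f t)))
   ((theta_part N (f t) - theta_part N l) + (theta_part N l - theta p l)).
have := nrmD (theta_part N (f t) - theta_part N l) (theta_part N l - theta p l).
rewrite nrmN; lra.
Qed.

(** Inversion exchanges the two families of factors up to a shift of the exponent by one. The
    boundary factors are multiplied across to make the identity exact for each N. *)
Lemma theta_partV N x : x != 0 -> theta_part N x^-1 * (1 - p ^+ N / x) * (1 - x) =
  theta_part N x * (1 - x^-1) * (1 - x * p ^+ N).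
Proof.
move=> x0; elim: N => [|N IH]; first by rewrite !theta_part0 expr0; ring.
rewrite !theta_partS invrK.
have -> : theta_part N x^-1 * ((1 - x^-1 * p ^+ N) * (1 - p ^+ N.+1 * x)) *
  (1 - p ^+ N.+1 / x) * (1 - x) = (theta_part N x^-1 * (1 - p ^+ N / x) * (1 - x)) *
   ((1 - p ^+ N.+1 * x) * (1 - p ^+ N.+1 / x)) by ring.
by rewrite IH; ring.
Qed.

Lemma cvg_exprC : p ^+ N @[N --> \oo] --> (0 : C).
Proof.
apply/cvg_nrmP.
rewrite [X in X @ _](_ : _ = fun N => 1 * nrm p ^+ N); first exact: cvg_geo.
by apply/funext => N; rewrite subr0 nrmX mul1r.
Qed.

Lemma theta1 : theta p 1 = 0.
Proof.
(* The shift skips the empty product, which is 1; all later ones contain the vanishing factor j =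
   0. *)
have h : theta_part N.+1 (1 : C) @[N --> \oo] --> theta p 1.
  by rewrite (cvg_shiftS (fun N => theta_part N 1)); exact: cvg_theta_part.
apply/esym/(cvg_unique (@norm_hausdorff _ _) _ h).
rewrite [X in X @ _](_ : _ = fun=> 0); first exact: cvg_cst.
apply/funext => N; rewrite /theta_part big_nat_recl//=.
by rewrite expr0 mulr1 subrr !mul0r.
Qed.

Lemma thetaV x : x != 0 -> theta p x^-1 = - theta p x / x.
Proof.
move=> x0; have [->|x1] := eqVneq x 1; first by rewrite invr1 theta1 oppr0 mul0r.
have h1 : theta_part N x^-1 * (1 - p ^+ N / x) * (1 - x) @[N --> \oo] -->
    theta p x^-1 * (1 - 0 / x) * (1 - x).
  apply: cvgM; last exact: cvg_cst.
  apply: cvgM; first exact: cvg_theta_part.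
  apply: cvgB; first exact: cvg_cst.
  by apply: cvgM; [exact: cvg_exprC|exact: cvg_cst].
have h2 : theta_part N x * (1 - x^-1) * (1 - x * p ^+ N) @[N --> \oo] -->
    theta p x * (1 - x^-1) * (1 - x * 0).
  apply: cvgM; first by apply: cvgM; [exact: cvg_theta_part|exact: cvg_cst].
  apply: cvgB; first exact: cvg_cst.
  by apply: cvgM; [exact: cvg_cst|exact: cvg_exprC].
move: h1; under eq_fun do rewrite theta_partV//.
move=> /(cvg_unique (@norm_hausdorff _ _) h2).
rewrite mul0r mulr0 subr0 !mulr1 => E.
apply: (@mulIf _ (1 - x)); first by rewrite subr_eq0 eq_sym.
by rewrite -E; field.
Qed.

End Theta.

(** * Tannery's theorem over the integer lattice *)

Section Tannery.
Variable R : realType.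
Local Notation C := (Cplx R).

Lemma ler_sum_uniq_sub (I : eqType) (g : I -> R) (s t : seq I) :
  (forall i, 0 <= g i) -> uniq s -> {subset s <= t} ->
  \sum_(i <- s) g i <= \sum_(i <- t) g i.
Proof.
move=> g0; elim: s t => [|x s IH] t; first by rewrite big_nil sumr_ge0.
move=> /= /andP[xs us] st; have xt : x \in t by rewrite st// mem_head.
rewrite big_cons (big_rem x xt)/= lerD2l IH// => y ys.
have : y \in t by rewrite st// in_cons ys orbT.
rewrite (perm_mem (perm_to_rem xt)) in_cons => /orP[/eqP yx|//].
by rewrite -yx ys in xs.
Qed.

Lemma big_uniq_split (V : zmodType) (I : eqType) (f : I -> V) (s t : seq I) :
  uniq s -> uniq t -> {subset s <= t} ->
  \sum_(i <- t) f i = \sum_(i <- s) f i + \sum_(i <- [seq i <- t | i \notin s]) f i.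
Proof.
move=> us ut st; rewrite -big_cat; apply: perm_big; apply: uniq_perm => //.
  rewrite cat_uniq us filter_uniq// andbT/=.
  by apply/hasPn => x; rewrite mem_filter => /andP[].
move=> x; rewrite mem_cat mem_filter; case: (boolP (x \in s)) => //= xs.
by rewrite st.
Qed.

(** Dominated convergence as a comparison of two families, each with its own terms and its own
    exhausting finite index sets. No infinite sum is ever formed, and neither family has to be shown
    to converge. *)
Lemma tannery (I : eqType) (g : I -> R) (B : R) (f h : nat -> I -> C)
    (F G : nat -> seq I) :
  (forall s, uniq s -> \sum_(i <- s) g i <= B) ->
  (forall N i, nrm (f N i) <= g i) -> (forall N i, nrm (h N i) <= g i) ->
  (forall i, f N i - h N i @[N --> \oo] --> (0 : C)) ->
  (forall N, uniq (F N)) -> (forall N, uniq (G N)) ->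
  (forall i, \forall N \near \oo, i \in F N) ->
  (forall i, \forall N \near \oo, i \in G N) ->
  \sum_(i <- F N) f N i - \sum_(i <- G N) h N i @[N --> \oo] --> (0 : C).
Proof.
move=> gB fg hg fh uF uG iF iG.
have g0 i : 0 <= g i by apply: le_trans (fg 0%N i); exact: nrm_ge0.
apply/cvg_nrmP/cvgr0Pnorm_lt => e e0.
(* [sup S] plays the role of the full sum of g; a finite H that nearly attains it leaves less than e
   / 3 of g outside H. *)
pose S := [set x : R | exists2 s, uniq s & x = \sum_(i <- s) g i].
have supS : has_sup S.
  split; first by exists 0; exists [::] => //; rewrite big_nil.
  by exists B => _ [s us ->]; exact: gB.
have e3 : 0 < e / 3 by rewrite divr_gt0.
have [_ [H uH ->] Hs] := sup_adherent e3 supS.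
have tail (f' : I -> C) t : (forall i, nrm (f' i) <= g i) -> uniq t ->
    {subset H <= t} -> nrm (\sum_(i <- t) f' i - \sum_(i <- H) f' i) < e / 3.
  move=> fg' ut Ht; rewrite (big_uniq_split _ uH ut Ht) addrC addKr.
  apply: le_lt_trans (nrm_sum _ _ _) _.
  apply: (@le_lt_trans _ _ (\sum_(i <- [seq i <- t | i \notin H]) g i)).
    exact: ler_sum.
  have : \sum_(i <- t) g i <= sup S by apply: ub_le_sup => //; [case: supS | exists t].
  by rewrite (big_uniq_split _ uH ut Ht); lra.
have sub (K : nat -> seq I) : (forall i, \forall N \near \oo, i \in K N) ->
    \forall N \near \oo, {subset H <= K N}.
  move=> iK; elim: (H) => [|x s IH]; first by apply: nearW => N x.
  by apply: filterS2 (iK x) IH => N xN sN y; rewrite in_cons => /orP[/eqP ->|/sN].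
have hH : \sum_(i <- H) (f N i - h N i) @[N --> \oo] --> (0 : C).
  elim: (H) => [|x s IH].
    by under eq_fun do rewrite big_nil; exact: cvg_cst.
  under eq_fun do rewrite big_cons.
  by have := cvgD (fh x) IH; rewrite addr0; apply.
move/cvg_nrmP/cvgr0Pnorm_lt/(_ _ e3) : hH => hH.
apply: filterS3 (sub F iF) (sub G iG) hH => N HF HG; rewrite !subr0.
rewrite !ger0_norm ?nrm_ge0// sumrB => hN.
have h1 := tail (f N) (F N) (fg N) (uF N) HF.
have h2 := tail (h N) (G N) (hg N) (uG N) HG.
move: h1 h2 hN.
set a := \sum_(i <- F N) _; set b := \sum_(i <- H) _; set c := \sum_(i <- G N) _.
set d := \sum_(i <- H) _ => h1 h2 hN.
have -> : a - c = (a - b) + ((b - d) - (c - d)) by ring.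
have := nrmD (a - b) ((b - d) - (c - d)); have := nrmB (b - d) (c - d); lra.
Qed.

(** The term is (z s^(n-1))^n, hence at most 1 once z s^(n-1) < 1; the finitely many earlier terms
    are bounded by their sum. *)
Lemma pow_gauss_bound (s z : R) : 0 <= s -> s < 1 -> 0 <= z ->
  exists2 B, 0 <= B & forall n : nat, z ^+ n * s ^+ (n * n.-1) <= B.
Proof.
move=> s0 s1 z0.
have : \forall n \near \oo, z * s ^+ n < 1 by apply: (cvgr_lt _ (cvg_geo s0 s1 z)).
move=> [m _ hm].
have g0 n : 0 <= z ^+ n * s ^+ (n * n.-1) by rewrite mulr_ge0 ?exprn_ge0.
exists (1 + \sum_(0 <= i < m.+1) z ^+ i * s ^+ (i * i.-1)).
  by rewrite addr_ge0 ?sumr_ge0.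
move=> n; have [nm|mn] := leqP n m.
  rewrite -[leLHS]add0r lerD// (bigD1_seq n) ?iota_uniq ?mem_index_iota//=.
  by rewrite lerDl sumr_ge0.
case: n mn => // n mn; apply: (@le_trans _ _ 1); last by rewrite lerDl sumr_ge0.
rewrite /= mulnC exprM -exprMn exprn_ile1// ?mulr_ge0 ?exprn_ge0// ltW//.
exact: hm.
Qed.

Lemma gauss_bound (s z : R) : 0 < s -> s < 1 -> 0 < z ->
  exists2 D, 0 <= D & forall k : int, z ^ k * s ^ (k * (k - 1)) <= D * 2^-1 ^+ `|k|%N.
Proof.
move=> s0 s1 z0.
(* The factor 2 pays for the geometric decay. For k = -m the term equals (s^2 / z)^m s^(m(m-1)),
   whence the second base. *)
have [B1 B10 h1] := @pow_gauss_bound s (2 * z) (ltW s0) s1 ltac:(lra).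
have [B2 B20 h2] := @pow_gauss_bound s (2 * (s ^+ 2 / z)) (ltW s0) s1
   ltac:(by rewrite mulr_ge0// divr_ge0 ?exprn_ge0// ltW).
have two n : (2 : R) ^+ n * 2^-1 ^+ n = 1 by rewrite -exprMn divff// expr1n.
exists (B1 + B2); first by rewrite addr_ge0.
case=> n.
  have -> : n%:Z * (n%:Z - 1) = (n * n.-1)%N%:Z by case: n => //; lia.
  rewrite -!exprnP absz_nat; apply: (@le_trans _ _ (B1 * 2^-1 ^+ n)); last first.
    by rewrite ler_wpM2r ?exprn_ge0// lerDl.
  have := h1 n; rewrite exprMn => h.
  have -> : z ^+ n * s ^+ (n * n.-1) =
     2 ^+ n * z ^+ n * s ^+ (n * n.-1) * 2^-1 ^+ n by rewrite -[LHS]mul1r -{1}(two n); ring.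
  by rewrite ler_wpM2r ?exprn_ge0.
rewrite NegzE abszN absz_nat; set m := n.+1.
have -> : - m%:Z * (- m%:Z - 1) = (m * m.-1 + 2 * m)%N%:Z by rewrite /m; lia.
rewrite -exprnN -exprnP exprD (exprM s 2); apply: (@le_trans _ _ (B2 * 2^-1 ^+ m)); last first.
  by rewrite ler_wpM2r ?exprn_ge0// lerDr.
have := h2 m; rewrite !exprMn => h.
have -> : z ^- m * (s ^+ (m * m.-1) * (s ^+ m * s ^+ m)) =
   2 ^+ m * (s ^+ m * s ^+ m * z^-1 ^+ m) * s ^+ (m * m.-1) * 2^-1 ^+ m.
  by rewrite exprVn -[LHS]mul1r -{1}(two m); ring.
by rewrite ler_wpM2r ?exprn_ge0.
Qed.

Lemma gauss_sum_bound (s z : R) : 0 < s -> s < 1 -> 0 < z ->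
  exists2 D, 0 <= D &
    forall t : seq int, uniq t -> \sum_(k <- t) z ^ k * s ^ (k * (k - 1)) <= D.
Proof.
move=> s0 s1 z0; have [D D0 hD] := gauss_bound s0 s1 z0.
have h2 : 1 - 2^-1 = 2^-1 :> R by lra.
have half M : \sum_(0 <= n < M) D * 2^-1 ^+ n <= D * 2.
  have := @geo_sum_le R 2^-1 ltac:(by []) ltac:(lra) D 0 M D0.
  by rewrite h2 invrK expr0 mulr1.
exists (D * 2 + D * 2); first by rewrite addr_ge0 ?mulr_ge0.
move=> t ut.
apply: (@le_trans _ _ (\sum_(k <- t) D * 2^-1 ^+ `|k|%N)); first exact: ler_sum.
pose M := (\max_(k <- t) `|k|%N).+1.
(* Any finite list of integers lies within distance less than M of 0. The index 0 occurs in both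
   halves, which only enlarges the bound. *)
apply: (@le_trans _ _ (\sum_(k <- [seq n%:Z | n <- index_iota 0 M] ++
    [seq - n%:Z | n <- index_iota 0 M]) D * 2^-1 ^+ `|k|%N)).
  apply: ler_sum_uniq_sub => // [i|k kt]; first by rewrite mulr_ge0 ?exprn_ge0.
  have kM : (`|k| < M)%N by rewrite ltnS; exact: (leq_bigmax_seq k kt isT).
  rewrite mem_cat; apply/orP; case: k kM {kt} => n; [left|right]; apply/mapP.
    by exists n => //; rewrite mem_index_iota.
  by exists n.+1; rewrite ?NegzE// mem_index_iota.
rewrite big_cat !big_map lerD// ?half//.
by under eq_bigr do rewrite abszN; exact: half.
Qed.

Lemma gauss_sum2_bound (s z1 z2 : R) : 0 < s -> s < 1 -> 0 < z1 -> 0 < z2 ->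
  exists D, forall t : seq (int * int), uniq t ->
  \sum_(k <- t) (z1 ^ k.1 * s ^ (k.1 * (k.1 - 1))) * (z2 ^ k.2 * s ^ (k.2 * (k.2 - 1))) <= D.
Proof.
move=> s0 s1 z10 z20; have [D1 D10 h1] := gauss_sum_bound s0 s1 z10.
have [D2 D20 h2] := gauss_sum_bound s0 s1 z20.
exists (D1 * D2) => t ut; pose t1 := undup (map fst t); pose t2 := undup (map snd t).
have g0 z k : 0 < z -> 0 <= z ^ k * s ^ (k * (k - 1)).
  by move=> z0; rewrite mulr_ge0// exprz_ge0// ltW.
(* The list is enclosed in the rectangle spanned by its two projections, over which the double sum
   factors. *)
apply: le_trans (ler_sum_uniq_sub (t := [seq (i, j) | i <- t1, j <- t2]) _ ut _) _.
- by move=> i; rewrite mulr_ge0 ?g0.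
- move=> [i j] ij; apply: allpairs_f; rewrite mem_undup.
    by apply/mapP; exists (i, j).
  by apply/mapP; exists (i, j).
rewrite big_allpairs/= -big_distrlr/= ler_pM ?h1 ?h2 ?undup_uniq//.
  by apply: sumr_ge0 => i _; exact: g0.
by apply: sumr_ge0 => i _; exact: g0.
Qed.

End Tannery.

(** * The Weierstrass addition formula *)

Section Weierstrass.
Variable R : realType.
Local Notation C := (Cplx R).
Variable p : C.
Hypothesis hp : nrm p < 1.

Definition qpoch (n : nat) : C := \prod_(0 <= j < n) (1 - p ^+ j.+1).

Lemma qpochS n : qpoch n.+1 = qpoch n * (1 - p ^+ n.+1).
Proof. by rewrite /qpoch big_nat_recr. Qed.

Lemma subr_exprp_neq0 n : 1 - p ^+ n.+1 != 0.
Proof.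
rewrite subr_eq0 eq_sym; apply/eqP => /(congr1 (@nrm R)) /eqP.
rewrite nrmX nrm1 => /eqP E.
by have := exprn_ilt1 n.+1 (nrm_ge0 p) hp; rewrite E ltxx.
Qed.

Lemma qpoch_neq0 n : qpoch n != 0.
Proof.
rewrite /qpoch prodf_seq_neq0; apply/allP => j _; exact: subr_exprp_neq0.
Qed.

(** A nonzero limit makes the reciprocals of [qpoch n] bounded and convergent, which both the
    domination and the limit of the binomials require. *)
Lemma cvg_qpoch : exists2 l : C, l != 0 & qpoch n @[n --> \oo] --> l.
Proof.
have hB j : nrm (- p ^+ j.+1) <= 1 * nrm p ^+ j.
  rewrite nrmN nrmX exprS ler_wpM2r ?exprn_ge0 ?nrm_ge0//; exact: ltW.
have [l hl _] := cvg_prodD1 (nrm_ge0 p) hp hB.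
exists l => //; apply: (lim_prodD1_neq0 (nrm_ge0 p) hp hB hl).
exact: subr_exprp_neq0.
Qed.

(** The Gaussian binomial coefficient in base p. The guard is essential because [m - i] truncates to
    0 beyond m. *)
Definition qbinom (m i : nat) : C :=
  if (i <= m)%N then qpoch m / (qpoch i * qpoch (m - i)) else 0.

Lemma qbinom0 m : qbinom m 0 = 1.
Proof. by rewrite /qbinom subn0 {2}/qpoch big_geq// mul1r divff ?qpoch_neq0. Qed.

Lemma qbinomS m i : (i <= m)%N ->
  qbinom m.+1 i.+1 = qbinom m i.+1 + p ^+ (m - i) * qbinom m i.
Proof.
move=> im; rewrite /qbinom ltnS im subSS.
have q0 : qpoch 0 = 1 by rewrite /qpoch big_geq.
have [mi|mi] := leqP m i.
  have -> : i = m by apply/eqP; rewrite eqn_leq im.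
  by rewrite subnn expr0 add0r q0 !mulr1 !divff ?qpoch_neq0 ?mulr1.
have -> : (m - i)%N = (m - i.+1).+1 by lia.
have n1 := qpoch_neq0 i; have n2 := qpoch_neq0 (m - i.+1).
have n3 := subr_exprp_neq0 i; have n4 := subr_exprp_neq0 (m - i.+1).
rewrite !qpochS.
have -> : p ^+ m.+1 = p ^+ i.+1 * p ^+ (m - i.+1).+1 by rewrite -exprD; congr (_ ^+ _); lia.
by field; rewrite n1 n2 n3 n4.
Qed.

Lemma qbinom_bounded : exists K, forall m i, nrm (qbinom m i) <= K.
Proof.
have [l l0 hl] := cvg_qpoch.
have /cvg_seq_bounded [M1 [_ h1]] : cvgn (fun n => nrm (qpoch n)).
  by apply/cvg_ex; exists (nrm l); exact: cvg_nrm.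
have /cvg_seq_bounded [M2 [_ h2]] : cvgn (fun n => nrm (qpoch n)^-1).
  by apply/cvg_ex; exists (nrm l^-1); apply: cvg_nrm; exact: (cvgV l0 hl).
have b1 n : nrm (qpoch n) <= `|M1| + 1.
  have := h1 (`|M1| + 1) ltac:(by rewrite (le_lt_trans (ler_norm _))// ltrDl) n Logic.I.
  by rewrite /= ger0_norm ?nrm_ge0.
have b2 n : nrm (qpoch n)^-1 <= `|M2| + 1.
  have := h2 (`|M2| + 1) ltac:(by rewrite (le_lt_trans (ler_norm _))// ltrDl) n Logic.I.
  by rewrite /= ger0_norm ?nrm_ge0.
have p1 : 0 <= `|M1| + 1 by rewrite addr_ge0.
have p2 : 0 <= `|M2| + 1 by rewrite addr_ge0.
exists ((`|M1| + 1) * ((`|M2| + 1) * (`|M2| + 1))) => m i; rewrite /qbinom.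
case: ifP => _; last by rewrite nrm0 !mulr_ge0.
by rewrite invfM !nrmM !ler_pM ?mulr_ge0 ?nrm_ge0.
Qed.

(* A square root of p turns the exponents k(k-1)/2 of the triple product into
   the integer exponents k(k-1). *)
Variable w : C.
Hypothesis (hw : w ^+ 2 = p) (w0 : w != 0).

(** Rothe's q-binomial theorem in base p = w^2; the induction step is the q-Pascal rule
    [qbinomS]. *)
Lemma gauss_binomial m y : \prod_(0 <= j < m) (1 + y * w ^+ (2 * j)) =
  \sum_(0 <= i < m.+1) qbinom m i * (w ^+ (i * i.-1) * y ^+ i).
Proof.
elim: m => [|m IH].
  by rewrite big_geq// big_nat1 qbinom0 !expr0 !mulr1.
rewrite big_nat_recr//= IH [RHS]big_nat_recl//= qbinom0 !expr0 !mulr1.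
have -> : \sum_(0 <= i < m.+1) qbinom m.+1 i.+1 * (w ^+ (i.+1 * i) * y ^+ i.+1) =
  \sum_(0 <= i < m.+1) qbinom m i.+1 * (w ^+ (i.+1 * i) * y ^+ i.+1) +
  \sum_(0 <= i < m.+1) qbinom m i * (w ^+ (i * i.-1) * y ^+ i) * (y * w ^+ (2 * m)).
  rewrite -big_split/=; apply: eq_big_nat => i /andP[_ im].
  rewrite qbinomS// mulrDl; congr (_ + _).
  have -> : p ^+ (m - i) * qbinom m i * (w ^+ (i.+1 * i) * y ^+ i.+1) =
     qbinom m i * (p ^+ (m - i) * w ^+ (i.+1 * i)) * y ^+ i.+1 by ring.
  rewrite -hw -exprM -exprD.
  have -> : (2 * (m - i) + i.+1 * i)%N = (i * i.-1 + 2 * m)%N by case: i im => //; nia.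
  by rewrite exprD exprS; ring.
rewrite mulrDr mulr1 -mulr_suml addrA; congr (_ + _).
rewrite big_nat_recl//= qbinom0 !expr0 !mulr1; congr (_ + _).
by rewrite [RHS]big_nat_recr//= [in X in _ = _ + X]/qbinom ltnn mul0r addr0.
Qed.

Definition zrange (N : nat) : seq int := [seq i%:Z - N%:Z | i <- index_iota 0 (2 * N).+1].

Lemma mem_zrange N k : (k \in zrange N) = (`|k| <= N)%N.
Proof.
apply/mapP/idP; first by case=> i; rewrite mem_index_iota => /andP[_ iN] ->; lia.
move=> kN; exists (absz (k + N%:Z)); last by lia.
by rewrite mem_index_iota; lia.
Qed.

Lemma uniq_zrange N : uniq (zrange N).
Proof. by rewrite map_inj_uniq ?iota_uniq// => i j /addIr []. Qed.

(** The general term (-x)^k p^(k(k-1)/2) of the Jacobi triple product. *)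
Definition jterm (x : C) (k : int) : C := (- x) ^ k * w ^ (k * (k - 1)).

Definition zbinom (N : nat) (k : int) : C :=
  if (`|k| <= N)%N then qbinom (2 * N) (absz (k + N%:Z)) else 0.

(** The right-hand factors are 1 - x p^(j-N). Those with j >= N are half of the theta factors; for i
    = N - j > 0, pulling out -x p^(-i) leaves 1 - p^i / x, the other half. The extracted monomials
    make up the prefactor. *)
Lemma theta_part_prod N x : x != 0 ->
  theta_part p N x * ((- x) ^+ N * w ^- (N * N.+1)) =
  \prod_(0 <= j < 2 * N) (1 + - x * w ^- (2 * N) * w ^+ (2 * j)).
Proof.
move=> x0; elim: N => [|N IH].
  by rewrite theta_part0 !big_geq// !expr0 invr1 !mulr1.
have -> : (2 * N.+1 = (2 * N).+2)%N by lia.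
(* Passing from N to N + 1 adds one factor at each end; after a shift of the index the middle is the
   product for N. *)
rewrite big_nat_recl// big_nat_recr//= muln0 expr0 mulr1.
have -> : \prod_(0 <= i < 2 * N) (1 + - x / w ^+ (2 * N).+2 * w ^+ (2 * i.+1)) =
   theta_part p N x * ((- x) ^+ N * w ^- (N * N.+1)).
  rewrite IH; apply: eq_bigr => i _.
  have -> : (2 * i.+1 = 2 * i + 2)%N by lia.
  rewrite -addn2 !exprD; field; rewrite ?expf_neq0//.
rewrite theta_partS -hw -!exprM.
have -> : (2 * (2 * N).+1 = 2 * N + (2 * N).+2)%N by lia.
have -> : (N.+1 * N.+2 = N * N.+1 + (2 * N).+2)%N by lia.
have -> : (2 * N.+1 = (2 * N).+2)%N by lia.
rewrite !exprD (exprS (- x) N).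
have h1 : w ^+ (2 * N).+2 != 0 by rewrite expf_neq0.
have h2 : w ^+ (N * N.+1) != 0 by rewrite expf_neq0.
move: (theta_part _ _ _) ((- x) ^+ N) (w ^+ (2 * N).+2) (w ^+ (N * N.+1)) (w ^+ N) h1 h2.
by move=> T X P W V h1 h2; field; rewrite x0 h1 h2.
Qed.

(** Rothe's theorem with m = 2N, recentred at i = k + N: the exponent i(i-1) - 2Ni equals k(k-1) -
    N(N+1), and the last part cancels the prefactor. *)
Lemma theta_part_sum N x : x != 0 ->
  theta_part p N x = \sum_(k <- zrange N) zbinom N k * jterm x k.
Proof.
move=> x0.
have c0 : (- x) ^+ N * w ^- (N * N.+1) != 0.
  by rewrite mulf_neq0 ?invr_eq0 ?expf_neq0 ?oppr_eq0.
apply: (mulIf c0); rewrite theta_part_prod// gauss_binomial /zrange big_map mulr_suml.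
apply: eq_big_nat => i /andP[_ iN]; rewrite /zbinom ifT; last by lia.
have -> : absz (i%:Z - N%:Z + N%:Z) = i by lia.
rewrite -mulrA; congr (_ * _); rewrite /jterm.
have nx0 : - x != 0 by rewrite oppr_eq0.
have Ex : (- x) ^+ i = (- x) ^ (i%:Z - N%:Z) * (- x) ^+ N.
  by rewrite !exprnP -expfzDr// subrK.
have Ew : w ^+ (i * i.-1) * (w ^- (2 * N)) ^+ i =
    w ^ ((i%:Z - N%:Z) * (i%:Z - N%:Z - 1)) * w ^- (N * N.+1).
  rewrite !exprnN !exprnP exprz_exp -!expfzDr//; congr (w ^ _).
  by case: i {iN Ex} => [|i]; lia.
rewrite exprMn Ex mulrCA Ew; ring.
Qed.

Lemma cvg_nat_shift (phi : nat -> nat) (c : nat) :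
  (forall N, (N - c <= phi N)%N) -> phi N @[N --> \oo] --> \oo.
Proof.
move=> h P [M _ MP]; exists (M + c)%N => // N /= MN.
by apply: MP => /=; apply: leq_trans (h N); lia.
Qed.

Lemma cvg_zbinom l : l != 0 -> qpoch n @[n --> \oo] --> l ->
  forall k, zbinom N k @[N --> \oo] --> l^-1.
Proof.
move=> l0 ql k.
have q1 : qpoch (2 * N) @[N --> \oo] --> l.
  by apply: cvg_comp ql; apply: (@cvg_nat_shift _ 0) => N; lia.
have q2 : qpoch (absz (k + N%:Z)) @[N --> \oo] --> l.
  by apply: cvg_comp ql; apply: (@cvg_nat_shift _ (absz k)) => N; lia.
have q3 : qpoch (2 * N - absz (k + N%:Z)) @[N --> \oo] --> l.
  have s3 : (2 * N - absz (k + N%:Z)%R)%N @[N --> \oo] --> \oo.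
    by apply: (@cvg_nat_shift _ (absz k)) => N; lia.
  exact: (cvg_comp _ _ s3 ql).
have q : qpoch (2 * N) / (qpoch (absz (k + N%:Z)) * qpoch (2 * N - absz (k + N%:Z)))
    @[N --> \oo] --> l / (l * l).
  by apply: cvgM; [exact: q1|apply: cvgV; [rewrite mulf_neq0|exact: cvgM]].
have -> : l^-1 = l / (l * l) by field.
apply: cvg_trans q; apply: near_eq_cvg; near=> N.
have kN : (`|k| <= N)%N by near: N; exact: nbhs_infty_ge.
by rewrite /zbinom kN /qbinom ifT//; lia.
Unshelve. all: by end_near. Qed.

(** For x = e^(iz) this truncates Jacobi's theta_3 of nome p, and [jsumB] truncates p^(-1/4)
    theta_2. *)
Definition jsumA (N : nat) (x : C) : C :=
  \sum_(i <- zrange N) x ^ (2 * i) * w ^ (2 * i * i).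
Definition jsumB (N : nat) (x : C) : C :=
  \sum_(i <- zrange N) x ^ (2 * i + 1) * w ^ (2 * i * i + 2 * i).

(* A pair (m, n) with m - n even has the form (i + j + 1, i - j + 1), and one
   with m - n odd the form (i + j + 1, i - j).  The shift by 1 in the even case
   makes both cases produce the same two one-variable sums. *)
Let rotated (N : nat) : seq (int * int) :=
  [seq (i + j + 1, i - j + 1) | i <- zrange N, j <- zrange N] ++
  [seq (i + j + 1, i - j) | i <- zrange N, j <- zrange N].

Let uniq_rotated N : uniq (rotated N).
Proof.
rewrite cat_uniq; apply/and3P; split.
- apply: allpairs_uniq; rewrite ?uniq_zrange// => -[i j] [i' j'] _ _ [h1 h2].
  by congr (_, _); lia.
- apply/hasPn => -[m n] /allpairsP[[i j] [_ _ [-> ->]]].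
  by apply/negP => /allpairsP[[i' j'] [_ _ [/= h1 h2]]]; lia.
- apply: allpairs_uniq; rewrite ?uniq_zrange// => -[i j] [i' j'] _ _ [h1 h2].
  by congr (_, _); lia.
Qed.

Let mem_rotated k : \forall N \near \oo, k \in rotated N.
Proof.
case: k => m n; exists (`|m| + `|n| + 2)%N => // N /= hN; rewrite mem_cat.
have e := divz_eq (m - n) 2; have r0 := modz_ge0 (m - n) (isT : 2 != 0 :> int).
have r2 := ltz_pmod (m - n) (isT : 0 < 2 :> int).
move: e r0 r2; set j := ((m - n) %/ 2)%Z; set r := ((m - n) %% 2)%Z => e r0 r2.
have /orP[/eqP rE|/eqP rE] : (r == 0) || (r == 1) by lia.
  apply/orP; left; apply/allpairsP; exists (n + j - 1, j) => /=.
  by rewrite !mem_zrange; split; [lia|lia|congr (_, _); lia].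
apply/orP; right; apply/allpairsP; exists (n + j, j) => /=.
by rewrite !mem_zrange; split; [lia|lia|congr (_, _); lia].
Qed.

(** The sign (-1)^(m+n) is + on the first class and - on the second, and the exponent of w is a
    function of i plus a function of j. Each class therefore factors into two single sums, and their
    difference is a 2 x 2 minor. *)
Let sum_rotated N x y : x != 0 -> y != 0 ->
  \sum_(k <- rotated N) jterm (x * y) k.1 * jterm (x / y) k.2 =
  x * (jsumB N x * jsumA N y - jsumA N x * jsumB N y).
Proof.
move=> x0 y0.
have xy (m n : int) : jterm (x * y) m * jterm (x / y) n =
    (-1) ^ (m + n) * (x ^ (m + n) * y ^ (m - n) * w ^ (m * (m - 1) + n * (n - 1))).
  rewrite /jterm -(mulN1r (x * y)) -(mulN1r (x / y)) !expfzMl !expfzDr ?oppr_eq0 ?oner_eq0//.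
  rewrite exprz_inv.
  move: ((-1) ^ m) ((-1) ^ n) (x ^ m) (x ^ n) (y ^ m) (y ^ (- n)).
  move: (w ^ (m * (m - 1))) (w ^ (n * (n - 1))).
  by move=> *; ring.
have sgn (k : int) : (-1) ^ (2 * k) = 1 :> C by rewrite -exprz_exp -exprnP sqrrN expr1n exp1rz.
rewrite big_cat !big_allpairs_dep/= mulrBr; congr (_ + _).
  rewrite /jsumA /jsumB big_distrlr/= mulr_sumr; apply: eq_bigr => i _.
  rewrite mulr_sumr; apply: eq_bigr => j _; rewrite xy.
  have -> : i + j + 1 + (i - j + 1) = 2 * (i + 1) by ring.
  have -> : i + j + 1 - (i - j + 1) = 2 * j by ring.
  have -> : (i + j + 1) * (i + j + 1 - 1) + (i - j + 1) * (i - j + 1 - 1) =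
     (2 * i * i + 2 * i) + 2 * j * j by ring.
  rewrite sgn mul1r; have -> : 2 * (i + 1) = 1 + (2 * i + 1) by ring.
  rewrite expfzDr// [w ^ (2 * i * i + 2 * i + _)]expfzDr// expr1z.
  move: (x ^ (2 * i + 1)) (y ^ (2 * j)) (w ^ (2 * i * i + 2 * i)) (w ^ (2 * j * j)).
  by move=> *; ring.
rewrite /jsumA /jsumB big_distrlr/= mulr_sumr -sumrN; apply: eq_bigr => i _.
rewrite mulr_sumr -sumrN; apply: eq_bigr => j _; rewrite xy.
have -> : i + j + 1 + (i - j) = 1 + 2 * i by ring.
have -> : i + j + 1 - (i - j) = 2 * j + 1 by ring.
have -> : (i + j + 1) * (i + j + 1 - 1) + (i - j) * (i - j - 1) =
   2 * i * i + (2 * j * j + 2 * j) by ring.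
rewrite expfzDr ?oppr_eq0 ?oner_eq0// sgn expr1z [x ^ (1 + _)]expfzDr//.
rewrite [w ^ (_ + (_ + _))]expfzDr// expr1z.
move: (x ^ (2 * i)) (y ^ (2 * j + 1)) (w ^ (2 * i * i)) (w ^ (2 * j * j + 2 * j)).
by move=> *; ring.
Qed.

Let nrm_jterm x k : nrm (jterm x k) = nrm x ^ k * nrm w ^ (k * (k - 1)).
Proof. by rewrite /jterm nrmM !nrm_exprz nrmN. Qed.

(** The partial theta products sum over a square with coefficients [zbinom], the minors over
    [rotated] with the limit coefficient 1 / l^2; [tannery] bridges both differences. *)
Lemma cvg_theta_mul l : l != 0 -> qpoch n @[n --> \oo] --> l ->
  forall x y, x != 0 -> y != 0 ->
  l^-1 * l^-1 * (x * (jsumB N x * jsumA N y - jsumA N x * jsumB N y)) @[N --> \oo] -->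
  theta p (x * y) * theta p (x / y).
Proof.
move=> l0 ql x y x0 y0.
have X0 : x * y != 0 by rewrite mulf_neq0.
have Y0 : x / y != 0 by rewrite mulf_neq0 ?invr_eq0.
have s0 : 0 < nrm w by rewrite nrm_gt0.
have s1 : nrm w < 1.
  by have := hp; rewrite -hw nrmX expr_lt1// nrm_ge0.
have [K hK] := qbinom_bounded.
have K0 : 0 <= K by apply: le_trans (hK 0%N 0%N); exact: nrm_ge0.
have zK N k : nrm (zbinom N k) <= K.
  by rewrite /zbinom; case: ifP => _; rewrite ?nrm0// hK.
have [D hD] := gauss_sum2_bound s0 s1
  (ltac:(by rewrite nrm_gt0) : 0 < nrm (x * y)) (ltac:(by rewrite nrm_gt0) : 0 < nrm (x / y)).
pose J (k : int * int) := jterm (x * y) k.1 * jterm (x / y) k.2.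
pose f N (k : int * int) := zbinom N k.1 * zbinom N k.2 * J k.
pose h (N : nat) (k : int * int) := l^-1 * l^-1 * J k.
(* One constant dominates both the products of two binomials and the limit coefficient. *)
pose c := K * K + nrm l^-1 * nrm l^-1.
have c0 : 0 <= c by rewrite addr_ge0 ?mulr_ge0 ?nrm_ge0.
pose F N := [seq (i, j) | i <- zrange N, j <- zrange N].
have T : \sum_(k <- F N) f N k - \sum_(k <- rotated N) h N k @[N --> \oo] --> (0 : C).
  apply: (@tannery _ _ (fun k => c * nrm (J k)) (c * D)).
  - move=> s us; rewrite -mulr_sumr ler_wpM2l//.
    by under eq_bigr do rewrite /J nrmM !nrm_jterm; exact: hD.
  - move=> N k; rewrite /f nrmM ler_wpM2r ?nrm_ge0// nrmM /c.
    by rewrite -[leLHS]addr0 lerD ?ler_pM ?nrm_ge0// mulr_ge0 ?nrm_ge0.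
  - move=> N k; rewrite /h nrmM ler_wpM2r ?nrm_ge0// nrmM /c.
    by rewrite -[leLHS]add0r lerD// mulr_ge0.
  - move=> k; rewrite /f /h -(subrr (l^-1 * l^-1 * J k)).
    apply: cvgB; last exact: cvg_cst.
    apply: cvgM; last exact: cvg_cst.
    by apply: cvgM; exact: cvg_zbinom.
  - by move=> N; apply: allpairs_uniq; rewrite ?uniq_zrange// => -[i j] [i' j'] _ _ [-> ->].
  - exact: uniq_rotated.
  - move=> [m n]; exists (`|m| + `|n|)%N => // N /= hN.
    by apply: allpairs_f; rewrite mem_zrange; lia.
  - exact: mem_rotated.
have FE N : \sum_(k <- F N) f N k = theta_part p N (x * y) * theta_part p N (x / y).
  rewrite !theta_part_sum// big_allpairs_dep/= big_distrlr/=.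
  by apply: eq_bigr => i _; apply: eq_bigr => j _; rewrite /f /J /=; ring.
have RE N : \sum_(k <- rotated N) h N k =
    l^-1 * l^-1 * (x * (jsumB N x * jsumA N y - jsumA N x * jsumB N y)).
  by rewrite -sum_rotated// mulr_sumr.
have E : theta_part p N (x * y) * theta_part p N (x / y) -
  (\sum_(k <- F N) f N k - \sum_(k <- rotated N) h N k) @[N --> \oo] -->
  theta p (x * y) * theta p (x / y) - 0.
  by apply: cvgB; [apply: cvgM; exact: cvg_theta_part|exact: T].
rewrite subr0 in E; apply: cvg_trans E; apply: near_eq_cvg; apply: nearW => N.
by rewrite -FE -RE subKr.
Qed.

(** The minors of the vectors (A, B) at x, y, u, v satisfy the Pluecker relation for every N. Each
    carries its first argument as a factor: x u on the left against y x on the right, which accounts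
    for u / y. *)
Lemma theta_addition_sqr x y u v : x != 0 -> y != 0 -> u != 0 -> v != 0 ->
  theta p (x * y) * theta p (x / y) * (theta p (u * v) * theta p (u / v)) -
  theta p (x * v) * theta p (x / v) * (theta p (u * y) * theta p (u / y)) =
  u / y * (theta p (y * v) * theta p (y / v) * (theta p (x * u) * theta p (x / u))).
Proof.
move=> x0 y0 u0 v0; have [l l0 ql] := cvg_qpoch.
pose P N x y := l^-1 * l^-1 * (x * (jsumB N x * jsumA N y - jsumA N x * jsumB N y)).
have H z t : z != 0 -> t != 0 -> P N z t @[N --> \oo] --> theta p (z * t) * theta p (z / t).
  exact: cvg_theta_mul.
have L : P N x y * P N u v - P N x v * P N u y @[N --> \oo] -->
    theta p (x * y) * theta p (x / y) * (theta p (u * v) * theta p (u / v)) -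
    theta p (x * v) * theta p (x / v) * (theta p (u * y) * theta p (u / y)).
  by apply: cvgB; apply: cvgM; exact: H.
have M : u / y * (P N y v * P N x u) @[N --> \oo] -->
    u / y * (theta p (y * v) * theta p (y / v) * (theta p (x * u) * theta p (x / u))).
  by apply: cvgM; [exact: cvg_cst|apply: cvgM; exact: H].
apply: (cvg_unique (@norm_hausdorff _ _) L).
rewrite [X in X @ _](_ : _ = fun N => u / y * (P N y v * P N x u)); first exact: M.
apply/funext => N; rewrite /P.
move: (jsumA N x) (jsumA N y) (jsumA N u) (jsumA N v)
  (jsumB N x) (jsumB N y) (jsumB N u) (jsumB N v).
by move=> *; field; rewrite l0 y0.
Qed.

End Weierstrass.

Section WeierstrassAll.
Variable R : realType.
Local Notation C := (Cplx R).

Lemma theta_at0 (x : C) : theta 0 x = 1 - x.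
Proof.
have h0 : nrm (0 : C) < 1 by rewrite nrm0.
have h : theta_part 0 N.+1 x @[N --> \oo] --> theta 0 x.
  by rewrite (cvg_shiftS (fun N => theta_part 0 N x)); exact: cvg_theta_part.
apply: (cvg_unique (@norm_hausdorff _ _) h).
rewrite [X in X @ _](_ : _ = fun=> 1 - x); first exact: cvg_cst.
apply/funext => N; elim: N => [|N IH].
  by rewrite theta_partS theta_part0 expr0 expr0n mul0r subr0 mul1r !mulr1.
by rewrite theta_partS IH !expr0n/= mulr0 mul0r subr0 !mulr1.
Qed.

(** The triple product uses negative powers of a root of p, so p = 0 is separate: there theta(x) = 1
    - x and the formula is a rational identity. *)
Lemma theta_addition (p x y u v : C) : nrm p < 1 ->
  x != 0 -> y != 0 -> u != 0 -> v != 0 ->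
  theta p (x * y) * theta p (x / y) * (theta p (u * v) * theta p (u / v)) -
  theta p (x * v) * theta p (x / v) * (theta p (u * y) * theta p (u / y)) =
  u / y * (theta p (y * v) * theta p (y / v) * (theta p (x * u) * theta p (x / u))).
Proof.
move=> hp x0 y0 u0 v0; have [->|p0] := eqVneq p 0.
  by rewrite !theta_at0; field; rewrite u0 v0 y0.
by apply: (@theta_addition_sqr R p hp (sqrtC p)); rewrite ?sqrtCK ?sqrtC_eq0.
Qed.

End WeierstrassAll.

(** * The three-term relation for elliptic numbers *)

(** The algebra of [ell_key] with every theta value replaced by a variable, so that [field] meets
    only atoms. The names spell the arguments at x = q^X, u = q^U, v = q^V; c stands for theta(x /
    u) and c' for the power x / u itself. *)
Lemma ratio_key (F : fieldType)
    (xv axv bqq a_b q1 aq bxv abxv c aux buqq abu auuq bx abx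
     x ax y auxv u au bu abuq v axxv bxqq abxq axxq c' : F) :
  q1 != 0 -> aq != 0 -> bxv != 0 -> abxv != 0 -> auuq != 0 -> bx != 0 -> abx != 0 ->
  bu != 0 -> abuq != 0 -> axxq != 0 -> bxqq != 0 -> abxq != 0 ->
  c * aux * (xv * axv) = x * ax * (y * auxv) - c' * (u * au) * (v * axxv) ->
  xv * axv * bqq * a_b / (q1 * aq * bxv * abxv) *
  (c * aux * buqq * abu / (q1 * auuq * bx * abx)) =
  x * ax * bqq * a_b / (q1 * aq * bx * abx) *
  (y * auxv * buqq * abu / (q1 * auuq * bxv * abxv)) -
  u * au * bqq * a_b / (q1 * aq * bu * abuq) *
  (v * axxv * bxqq * abxq / (q1 * axxq * bxv * abxv)) *
  (axxq * bu * buqq * abuq * abu / (auuq * bx * bxqq * abx * abxq) * c').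
Proof.
move=> *; pose cf := bqq * a_b * buqq * abu / (q1 * q1 * aq * bxv * abxv * auuq * bx * abx).
(* cf is the quotient of the left-hand side by the three-term expression of the hypothesis. *)
transitivity (c * aux * (xv * axv) * cf); rewrite /cf.
  by field; do ![apply/andP; split].
match goal with H : c * _ * _ = _ |- _ => rewrite H end.
by field; do ![apply/andP; split].
Qed.

Section KeyIdentity.
Variable R : realType.
Local Notation C := (Cplx R).
Variables (l p a b : C).
Hypotheses (hp : nrm p < 1) (a0 : a != 0) (b0 : b != 0).
Local Notation q := (cexp l).
Local Notation "q^ z" := (qpow l z) (at level 8, z at level 8).
Local Notation t := (theta p).

Lemma qpowD z1 z2 : q^(z1 + z2) = q^z1 * q^z2.
Proof. by rewrite /qpow mulrDl cexpD. Qed.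

Lemma qpowN z : q^(- z) = (q^z)^-1.
Proof. by rewrite /qpow mulNr cexpN. Qed.

Lemma qpow1 : q^1 = q.
Proof. by rewrite /qpow mul1r. Qed.

Lemma qpow_neq0 z : q^z != 0.
Proof. exact: cexp_neq0. Qed.

Lemma qpow2M z : q^(2 * z) = q^z * q^z.
Proof. by rewrite mulrDl mul1r qpowD. Qed.

Lemma ell_num_denE z : ell_num_den l p a b z =
  t q * t (a * q) * t (b * q^z * q) * t (a * q^z / (b * q)).
Proof.
rewrite /ell_num_den /thetas !big_cons big_nil mulr1 !mulrA.
rewrite !qpowD qpowN qpow1 mulrA; congr (_ * t _).
by field; rewrite b0 cexp_neq0.
Qed.

Lemma ell_numE z : ell_num l p a b z =
  t q^z * t (a * q^z) * t (b * q ^+ 2) * t (a / b) /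
  (t q * t (a * q) * t (b * q^z * q) * t (a * q^z / (b * q))).
Proof.
by rewrite -ell_num_denE /ell_num /thetas !big_cons big_nil mulr1 !mulrA.
Qed.

End KeyIdentity.

Section KeyIdentitySh.
Variable R : realType.
Local Notation C := (Cplx R).
Variables (l p a b : C).
Hypotheses (hp : nrm p < 1) (a0 : a != 0) (b0 : b != 0).
Local Notation q := (cexp l).
Local Notation "q^ z" := (qpow l z) (at level 8, z at level 8).
Local Notation t := (theta p).

(** The shift s merges with z: the last two factors depend on s + z only. Hence terms with different
    shifts share denominator factors. *)
Lemma ell_num_den_shE s z : ell_num_den_sh l p a b s z =
  t q * t (a * q^s ^+ 2 * q) * t (b * q^(s + z) * q) * t (a * q^(s + z) / (b * q)).
Proof.
have s0 := qpow_neq0 l s; rewrite /ell_num_den_sh ell_num_denE ?mulf_neq0//.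
rewrite qpow2M expr2 qpowD; congr (_ * t _ * t _); first by rewrite !mulrA.
by field; rewrite b0 cexp_neq0 s0.
Qed.

Lemma ell_num_shE s z : ell_num_sh l p a b s z =
  t q^z * t (a * (q^s * q^(s + z))) * t (b * q^s * q ^+ 2) * t (a * q^s / b) /
  (t q * t (a * q^s ^+ 2 * q) * t (b * q^(s + z) * q) * t (a * q^(s + z) / (b * q))).
Proof.
have s0 := qpow_neq0 l s; rewrite -ell_num_den_shE /ell_num_sh ell_numE ?mulf_neq0//.
rewrite -[X in _ / X]ell_num_denE ?mulf_neq0// -/(ell_num_den_sh _ _ _ _ _ _).
congr (_ / _); rewrite qpow2M qpowD; congr (_ * t _ * _ * t _); first by ring.
by field; rewrite b0 s0.
Qed.

Lemma ell_weight_den_shE s k : ell_weight_den_sh l p a b s k =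
  t (a * q^s ^+ 2 * q) * t (b * q^(s + k) * q) * t (b * q^(s + k) * q ^+ 2) *
  t (a * q^(s + k) / (b * q)) * t (a * q^(s + k) / b).
Proof.
have s0 := qpow_neq0 l s; have q0 := cexp_neq0 l.
rewrite /ell_weight_den_sh /ell_weight_den /thetas !big_cons big_nil mulr1 !mulrA.
rewrite qpow2M !qpowD qpowN qpow1; congr (t _ * t _ * t _ * t _ * t _).
- by ring.
- by ring.
- by ring.
- by field; rewrite b0 s0 q0.
- by field; rewrite b0 s0.
Qed.

Lemma ell_weight_shE s k : ell_weight_sh l p a b s k =
  t (a * q^(s + k) ^+ 2 * q) * t (b * q^s * q) * t (b * q^s * q ^+ 2) *
  t (a * q^s / (b * q)) * t (a * q^s / b) /
  (t (a * q^s ^+ 2 * q) * t (b * q^(s + k) * q) * t (b * q^(s + k) * q ^+ 2) *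
   t (a * q^(s + k) / (b * q)) * t (a * q^(s + k) / b)) * q^k.
Proof.
have s0 := qpow_neq0 l s; have q0 := cexp_neq0 l.
rewrite -ell_weight_den_shE /ell_weight_sh /ell_weight -/(ell_weight_den_sh _ _ _ _ _ _).
congr (_ / _ * _); rewrite /thetas !big_cons big_nil mulr1 !mulrA.
rewrite !qpow2M !qpowD qpow2M qpow1.
congr (t _ * t _ * t _ * t _ * t _).
- by ring.
- by field; rewrite b0 s0 q0.
- by field; rewrite b0 s0.
Qed.

(* The addition formula at (r x v, r, r x, r u), where r^2 = a. *)
Lemma theta_key x u v : x != 0 -> u != 0 -> v != 0 ->
  t (x * v) * t (a * (x * v)) * t (x / u) * t (a * (u * x)) =
  t x * t (a * x) * t (x * v / u) * t (a * (u * (x * v))) -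
  x / u * (t u * t (a * u) * t v * t (a * (x * (x * v)))).
Proof.
move=> x0 u0 v0; pose r := sqrtC a.
have rr : r * r = a by rewrite -expr2 sqrtCK.
have r0 : r != 0 by rewrite sqrtC_eq0.
have := @theta_addition R p (r * (x * v)) r (r * x) (r * u) hp.
rewrite !mulf_neq0// => /(_ isT r0 isT isT).
have -> : r * (x * v) * r = a * (x * v) by rewrite -rr; ring.
have -> : r * (x * v) / r = x * v by field.
have -> : r * x * (r * u) = a * (u * x) by rewrite -rr; ring.
have -> : r * x / (r * u) = x / u by field; rewrite u0 r0.
have -> : r * (x * v) * (r * u) = a * (u * (x * v)) by rewrite -rr; ring.
have -> : r * (x * v) / (r * u) = x * v / u by field; rewrite u0 r0.
have -> : r * x * r = a * x by rewrite -rr; ring.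
have -> : r * x / r = x by field.
have -> : r * (r * u) = a * u by rewrite -rr; ring.
have -> : r / (r * u) = u^-1 by field; rewrite u0 r0.
have -> : r * (x * v) * (r * x) = a * (x * (x * v)) by rewrite -rr; ring.
have -> : r * (x * v) / (r * x) = v by field; rewrite x0 r0.
rewrite thetaV// => E.
have -> : t (x * v) * t (a * (x * v)) * t (x / u) * t (a * (u * x)) =
  t x * t (a * x) * t (x * v / u) * t (a * (u * (x * v))) +
  (t (a * (x * v)) * t (x * v) * (t (a * (u * x)) * t (x / u)) -
   t (a * (u * (x * v))) * t (x * v / u) * (t (a * x) * t x)) by ring.
by rewrite E; field.
Qed.

(** This is [theta_key] at q^X, q^U, q^V times the theta factors common to its three terms. The
    weight carries the base shift from X to U, and its power q^(X-U) is the coefficient x / u. *)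
Lemma ell_key X U V :
  ell_num_den l p a b (X + V) != 0 -> ell_num_den_sh l p a b U (X - U) != 0 ->
  ell_num_den l p a b U != 0 -> ell_num_den_sh l p a b X V != 0 ->
  ell_weight_den_sh l p a b U (X - U) != 0 ->
  ell_num l p a b (X + V) * ell_num_sh l p a b U (X - U) =
  ell_num l p a b X * ell_num_sh l p a b U (X + V - U) -
  ell_num l p a b U * ell_num_sh l p a b X V * ell_weight_sh l p a b U (X - U).
Proof.
rewrite !ell_num_denE// !ell_num_den_shE ell_weight_den_shE !ell_numE// !ell_num_shE.
rewrite ell_weight_shE.
have -> : U + (X - U) = X by ring.
have -> : U + (X + V - U) = X + V by ring.
rewrite !mulf_eq0 !negb_or.
move=> /andP[/andP[/andP[? ?] ?] ?] /andP[/andP[/andP[_ ?] ?] ?] /andP[/andP[/andP[_ _] ?] ?]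
  /andP[/andP[/andP[_ ?] _] _] /andP[/andP[/andP[/andP[_ _] ?] _] ?].
have := @theta_key q^X q^U q^V (qpow_neq0 _ _) (qpow_neq0 _ _) (qpow_neq0 _ _).
rewrite -!qpowD.
have -> : q^X / q^U = q^(X - U) by rewrite -qpowN -qpowD.
have -> : q^(X + V) / q^U = q^(X + V - U) by rewrite -qpowN -qpowD.
move=> key; apply: ratio_key => //.
rewrite [LHS](_ : _ = t q^(X + V) * t (a * q^(X + V)) * t q^(X - U) * t (a * q^(U + X))).
  by rewrite key; move: (t _) (t _) => *; ring.
by ring.
Qed.

End KeyIdentitySh.

(** * Telescoping *)

(** From one summand to the next the weight gains f k / (m k.+1 * w k.+1), which turns the second
    half of summand k.+1 into minus the first half of summand k. The last first half and the initial
    second half survive. *)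
Lemma telescope_ratio (F : fieldType) (n : nat) (A E f m w : nat -> F) (D : F) :
  (forall k, (k <= n)%N -> A k = E k.+1 * f k - E k * m k * w k) ->
  (forall j, (j < n)%N -> m j.+1 != 0 /\ w j.+1 != 0) ->
  \sum_(0 <= k < n.+1) (A k / D * (\prod_(0 <= j < k) (f j / m j.+1)) *
     (\prod_(0 <= j < k) (w j.+1)^-1)) =
  E n.+1 * f 0%N / D * (\prod_(1 <= j < n.+1) (f j / m j)) *
    (\prod_(1 <= j < n.+1) (w j)^-1) - E 0%N * m 0%N / D * w 0%N.
Proof.
elim: n => [|n IH] hA hm.
  by rewrite big_nat1 !big_geq// hA// !mulr1; ring.
rewrite big_nat_recr//= IH; last 2 first.
- by move=> k kn; apply: hA; apply: leqW.
- by move=> j jn; apply: hm; apply: ltnW.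
have [m0 w0] := hm n (ltnSn n).
(* Realigns f j over m j.+1 to f j over m j; the end factors f 0 and m k.+1 are left over. *)
have shift k : \prod_(0 <= j < k.+1) (f j / m j.+1) =
    f 0%N * (\prod_(1 <= j < k.+1) (f j / m j)) / m k.+1.
  elim: k => [|k IHk]; first by rewrite big_nat1 big_geq// mulr1.
  by rewrite big_nat_recr//= IHk [in RHS]big_nat_recr//=; ring.
rewrite shift hA// [in RHS]big_nat_recr//= -(big_add1 _ _ 0 n.+2 xpredT (fun j => (w j)^-1)).
rewrite ![\prod_(1 <= j < n.+2) _]big_nat_recr//=.
move: (\prod_(1 <= j < n.+1) _) (\prod_(1 <= j < n.+1) _) D^-1 => P Q D'.
by field; rewrite m0 w0.
Qed.

Section Identity.
Variable R : realType.
Local Notation C := (Cplx R).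

Lemma lhs_eq_rhs (p : C) (n : nat) (x : params R) : nrm p < 1 ->
  lhs_regular p n x -> rhs_regular p n x -> lhs p n x = rhs p n x.
Proof.
case: x => [[[[[[a b] l] c] d] g] h] hp.
move=> [[a0 b0] [D0 _] [Ds _] hk hj] [[_ _ Dn Dsv] _ _ [Dv0 Dv1 Dw] hr].
(* [S k] is s_{k-1} in the notation of the header. *)
pose S k := (g * k%:R - g + c) * (h * k%:R + d).
pose v k := (g * k%:R + g + c) * (h * k%:R + d).
pose V k := (g * k%:R + c) * (h * k%:R - h + d).
have VS k : V k.+1 = v k by rewrite /V /v -natr1; ring.
have S0 : S 0%N = (c - g) * d by rewrite /S; ring.
have S1 : S 1%N = c * (h + d) by rewrite /S; ring.
have V0 : V 0%N = c * (d - h) by rewrite /V; ring.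
have v0 : v 0%N = (g + c) * d by rewrite /v; ring.
have SS k : (g * k%:R + c) * (h * k%:R + h + d) = S k.+1.
  by rewrite /S -natr1; ring.
have SSS k : (g * k%:R + g + c) * (h * k%:R + 2 * h + d) = S k.+2.
  by rewrite /S -2!natr1; ring.
have dS k : 2 * g * h * k%:R + c * h + d * g = S k.+1 - S k.
  by rewrite /S -natr1; ring.
have dS1 k : 2 * g * h * k%:R + 2 * g * h + c * h + d * g = S k.+2 - S k.+1.
  by rewrite /S -2!natr1; ring.
have SV k : 2 * (g * k%:R + c) * (h * k%:R + d) = S k.+1 + V k.
  by rewrite /S /V -natr1; ring.
have vE k : v k = S k.+1 + V k - S k by rewrite /S /V /v -natr1; ring.
have dS0 : c * h + d * g = S 1%N - S 0%N by rewrite S0 S1; ring.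
pose N0 := ell_num l p a b; pose N := ell_num_sh l p a b; pose W := ell_weight_sh l p a b.
have key k : (k <= n)%N ->
    N0 (S k.+1 + V k) * N (S k) (S k.+1 - S k) =
    N0 (S k.+1) * N (S k) (v k) - N0 (S k) * N (S k.+1) (V k) * W (S k) (S k.+1 - S k).
  move=> kn; rewrite vE; have [h1 h2] := hk k kn.
  rewrite SV in h1; rewrite dS -/(S k) in h2.
  apply: ell_key => //.
  (* At k = 0 the boundary term of [rhs] supplies this denominator. Otherwise theta(q) and theta(a
     q) come from the N0 denominator one index earlier, and the two factors in q^(S k.+1) from that
     of [N (S k) (S k.+1 - S k)]. *)
  - case: k kn {h1 h2} => [|k] kn; first by rewrite S0.
    have [_] := hk k (ltnW kn); rewrite dS -/(S k).
    have [+ _] := hk k (ltnW kn).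
    rewrite !ell_num_denE// ell_num_den_shE//.
    have -> : S k + (S k.+1 - S k) = S k.+1 by ring.
    rewrite !mulf_eq0 !negb_or => /andP[/andP[/andP[-> ->] _] _].
    by move=> /andP[/andP[/andP[_ _] ->] ->].
  - case: k kn {h1 h2} => [|k] kn; first by rewrite S1 V0.
    by have [_ + _ _ _] := hj k kn; rewrite SSS -/(v k) VS.
  - case: k kn {h1 h2} => [|k] kn; first by rewrite S0 -S0 -dS0 S0.
    by have [_ _ _ + _] := hj k kn; rewrite SS dS1.
have T := @telescope_ratio C n (fun k => N0 (S k.+1 + V k) * N (S k) (S k.+1 - S k))
  (fun k => N0 (S k)) (fun k => N (S k) (v k)) (fun k => N (S k.+1) (V k))
  (fun k => W (S k) (S k.+1 - S k)) (N0 (2 * c * d) * N (S 0%N) (S 1%N - S 0%N)) key.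
transitivity (\sum_(0 <= k < n.+1)
    (N0 (S k.+1 + V k) * N (S k) (S k.+1 - S k) /
     (N0 (2 * c * d) * N (S 0%N) (S 1%N - S 0%N)) *
     (\prod_(0 <= j < k) (N (S j) (v j) / N (S j.+2) (V j.+1))) *
     (\prod_(0 <= j < k) (W (S j.+1) (S j.+2 - S j.+1))^-1))).
  rewrite /lhs -S0 dS0; apply: eq_big_nat => k _; rewrite SV dS -/(S k).
  congr (_ * _ * _); apply: eq_bigr => j _; first by rewrite SSS VS.
  by rewrite SS dS1.
rewrite T; last first.
  move=> j jn; have [_ _ + _ +] := hj j jn.
  by rewrite SSS -/(v j) -VS SS dS1.
rewrite /rhs SS -S0 -v0 -V0 -S1 dS0; congr (_ * _ * _ - _).
- by apply: eq_bigr => j _; rewrite SS.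
- by apply: eq_bigr => j _; rewrite dS.
Qed.

End Identity.

(** * Persistence of regularity along a filter *)

Section Persistence.
Variables (R : realType) (T : Type) (F : set_system T).
Context {FF : Filter F}.
Local Notation C := (Cplx R).
Variables (p : C) (t0 : T) (sc ex : (T -> C) -> Prop).

(* [sc] holds the admissible values of log q, c, d, g, h and [ex] those of a, b
   and of the arguments of theta.  The two instances are convergence along a
   filter ([cvg_stable_classes]) and polynomial dependence on a real parameter
   along the cocountable filter ([poly_stable_classes]). *)
Record stable_classes : Prop := StableClasses {
  sc_cst : forall z : C, sc (fun=> z);
  sc_add : forall f g, sc f -> sc g -> sc (fun t => f t + g t);
  sc_opp : forall f, sc f -> sc (fun t => - f t);
  sc_mul : forall f g, sc f -> sc g -> sc (fun t => f t * g t);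
  ex_exp : forall f, sc f -> ex (fun t => cexp (f t));
  ex_mul : forall f g, ex f -> ex g -> ex (fun t => f t * g t);
  ex_inv : forall f, ex f -> ex (fun t => (f t)^-1);
  ex_neq0 : forall f : T -> C, ex f -> \forall t \near F, f t != 0;
  ex_theta : forall f : T -> C, ex f -> theta p (f t0) != 0 -> \forall t \near F, theta p (f t) != 0
}.

Hypothesis H : stable_classes.

Lemma ex_qpow l z : sc l -> sc z -> ex (fun t => qpow (l t) (z t)).
Proof. by move=> hl hz; apply: ex_exp => //; exact: sc_mul. Qed.

Lemma ex_exprn f n : ex f -> ex (fun t => f t ^+ n.+1).
Proof.
move=> hf; elim: n => [|n IH]; first by under eq_fun do rewrite expr1.
by under eq_fun do rewrite exprS; exact: ex_mul.
Qed.

Fixpoint all_ex (fs : seq (T -> C)) : Prop :=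
  if fs is f :: fs' then ex f /\ all_ex fs' else True.

Lemma near_thetas fs : all_ex fs -> thetas p [seq f t0 | f <- fs] != 0 ->
  \forall t \near F, thetas p [seq f t | f <- fs] != 0.
Proof.
elim: fs => [_ _|f fs IH [hf hfs]].
  by apply: nearW => t; rewrite /thetas big_nil oner_neq0.
rewrite /thetas big_cons mulf_eq0 negb_or => /andP[h1 h2].
apply: filterS2 (ex_theta H hf h1) (IH hfs h2) => t k1 k2.
by rewrite /= big_cons mulf_neq0.
Qed.

End Persistence.

(** Syntax-directed membership proof. Products belong to both classes, so the type of H is matched
    against the class of the goal to choose between [sc_mul] and [ex_mul]. *)
Ltac solve_classes H :=
  simpl all_ex;
  lazymatch goal with
  | |- True => exact I
  | |- _ /\ _ => split; solve_classes H
  | A : ?s ?f |- ?s ?f => exact A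
  | |- ?s ?f =>
    lazymatch f with
    | (fun t => cexp (@?f t)) => refine (ex_exp H (f := f) _)
    | (fun t => qpow (@?f t) (@?g t)) => refine (ex_qpow H (l := f) (z := g) _ _)
    | (fun t => @?f t + @?g t) => refine (sc_add H (f := f) (g := g) _ _)
    | (fun t => - @?f t) => refine (sc_opp H (f := f) _)
    | (fun t => @?f t * @?g t) =>
        lazymatch type of H with
        | stable_classes _ _ _ s _ => refine (sc_mul H (f := f) (g := g) _ _)
        | _ => refine (ex_mul H (f := f) (g := g) _ _)
        end
    | (fun t => @?f t ^+ (S ?n)) => refine (ex_exprn H n (f := f) _)
    | (fun t => (@?f t)^-1) => refine (ex_inv H (f := f) _)
    | (fun t => ?h t) => match goal with A : s h |- _ => exact A end
    | (fun t => ?z) => exact (sc_cst H z)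
    end; solve_classes H
  end.

Section PersistenceElliptic.
Variables (R : realType) (T : Type) (F : set_system T).
Context {FF : Filter F}.
Local Notation C := (Cplx R).
Variables (p : C) (t0 : T) (sc ex : (T -> C) -> Prop).
Hypothesis H : stable_classes F p t0 sc ex.
Variables (l a b : T -> C).
Hypotheses (hl : sc l) (ha : ex a) (hb : ex b).

Lemma near_num_den z : sc z -> ell_num_den (l t0) p (a t0) (b t0) (z t0) != 0 ->
  \forall t \near F, ell_num_den (l t) p (a t) (b t) (z t) != 0.
Proof.
move=> hz; apply: (@near_thetas _ _ _ FF _ _ _ _ H [:: fun t => cexp (l t);
  fun t => a t * cexp (l t); fun t => b t * qpow (l t) (z t + 1);
  fun t => a t * qpow (l t) (z t - 1) / b t]).
solve_classes H.
Qed.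

Lemma near_num z : sc z -> ell_num (l t0) p (a t0) (b t0) (z t0) != 0 ->
  \forall t \near F, ell_num (l t) p (a t) (b t) (z t) != 0.
Proof.
(* As 0^-1 = 0, a nonzero quotient already has a nonzero denominator. *)
move=> hz; rewrite mulf_eq0 invr_eq0 negb_or => /andP[h1 h2].
have := @near_thetas _ _ _ FF _ _ _ _ H [:: fun t => qpow (l t) (z t);
  fun t => a t * qpow (l t) (z t); fun t => b t * cexp (l t) ^+ 2; fun t => a t / b t].
move=> /(_ ltac:(solve_classes H) h1) => k1.
apply: filterS2 k1 (near_num_den hz h2) => t.
by move=> k1 k2; rewrite mulf_neq0// invr_eq0.
Qed.

Lemma near_weight_den z : sc z -> ell_weight_den (l t0) p (a t0) (b t0) (z t0) != 0 ->
  \forall t \near F, ell_weight_den (l t) p (a t) (b t) (z t) != 0.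
Proof.
move=> hz; apply: (@near_thetas _ _ _ FF _ _ _ _ H [:: fun t => a t * cexp (l t);
  fun t => b t * qpow (l t) (z t + 1); fun t => b t * qpow (l t) (z t + 2);
  fun t => a t * qpow (l t) (z t - 1) / b t; fun t => a t * qpow (l t) (z t) / b t]).
solve_classes H.
Qed.

Lemma near_weight z : sc z -> ell_weight (l t0) p (a t0) (b t0) (z t0) != 0 ->
  \forall t \near F, ell_weight (l t) p (a t) (b t) (z t) != 0.
Proof.
move=> hz; rewrite !mulf_eq0 invr_eq0 !negb_or => /andP[/andP[h1 h2] _].
have := @near_thetas _ _ _ FF _ _ _ _ H [:: fun t => a t * qpow (l t) (2 * z t + 1);
  fun t => b t * cexp (l t); fun t => b t * cexp (l t) ^+ 2;
  fun t => a t * (cexp (l t))^-1 / b t; fun t => a t / b t].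
move=> /(_ ltac:(solve_classes H) h1) => k1.
apply: filterS2 k1 (near_weight_den hz h2) => t.
by move=> k1 k2; rewrite !mulf_neq0 ?invr_eq0 ?qpow_neq0.
Qed.

End PersistenceElliptic.

Section PersistenceShifted.
Variables (R : realType) (T : Type) (F : set_system T).
Context {FF : Filter F}.
Local Notation C := (Cplx R).
Variables (p : C) (t0 : T) (sc ex : (T -> C) -> Prop).
Hypothesis H : stable_classes F p t0 sc ex.
Variables (l a b : T -> C).
Hypotheses (hl : sc l) (ha : ex a) (hb : ex b).

Lemma near_num_den_sh s z : sc s -> sc z ->
  ell_num_den_sh (l t0) p (a t0) (b t0) (s t0) (z t0) != 0 ->
  \forall t \near F, ell_num_den_sh (l t) p (a t) (b t) (s t) (z t) != 0.
Proof.
move=> hs hz; apply: (@near_num_den _ _ _ FF _ _ _ _ H l (fun t => a t * qpow (l t) (2 * s t))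
  (fun t => b t * qpow (l t) (s t))) => //; solve_classes H.
Qed.

Lemma near_num_sh s z : sc s -> sc z ->
  ell_num_sh (l t0) p (a t0) (b t0) (s t0) (z t0) != 0 ->
  \forall t \near F, ell_num_sh (l t) p (a t) (b t) (s t) (z t) != 0.
Proof.
move=> hs hz; apply: (@near_num _ _ _ FF _ _ _ _ H l (fun t => a t * qpow (l t) (2 * s t))
  (fun t => b t * qpow (l t) (s t))) => //; solve_classes H.
Qed.

Lemma near_weight_den_sh s z : sc s -> sc z ->
  ell_weight_den_sh (l t0) p (a t0) (b t0) (s t0) (z t0) != 0 ->
  \forall t \near F, ell_weight_den_sh (l t) p (a t) (b t) (s t) (z t) != 0.
Proof.
move=> hs hz; apply: (@near_weight_den _ _ _ FF _ _ _ _ H l (fun t => a t * qpow (l t) (2 * s t))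
  (fun t => b t * qpow (l t) (s t))) => //; solve_classes H.
Qed.

Lemma near_weight_sh s z : sc s -> sc z ->
  ell_weight_sh (l t0) p (a t0) (b t0) (s t0) (z t0) != 0 ->
  \forall t \near F, ell_weight_sh (l t) p (a t) (b t) (s t) (z t) != 0.
Proof.
move=> hs hz; apply: (@near_weight _ _ _ FF _ _ _ _ H l (fun t => a t * qpow (l t) (2 * s t))
  (fun t => b t * qpow (l t) (s t))) => //; solve_classes H.
Qed.

End PersistenceShifted.

Section PersistenceRegular.
Variables (R : realType) (T : Type) (F : set_system T).
Context {FF : Filter F}.
Local Notation C := (Cplx R).
Variables (p : C) (t0 : T) (sc ex : (T -> C) -> Prop).
Hypothesis H : stable_classes F p t0 sc ex.
Variables (a b l c d g h : T -> C).
Hypotheses (ha : ex a) (hb : ex b) (hl : sc l) (hc : sc c) (hd : sc d) (hg : sc g)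
  (hh : sc h).
Local Notation pt t := (a t, b t, l t, c t, d t, g t, h t).

(** A filter is closed under finite intersections only; the bound n makes the quantifier finite. *)
Lemma near_forall_le (Q : nat -> T -> Prop) (P : nat -> bool) n :
  (forall k, P k -> (k <= n)%N) ->
  (forall k, P k -> \forall t \near F, Q k t) ->
  \forall t \near F, forall k, P k -> Q k t.
Proof.
move=> Pn hQ.
have : \forall t \near F, forall k, (k <= n)%N -> P k -> Q k t.
  elim: n {Pn} => [|n IH].
    have [P0|P0] := boolP (P 0%N).
      by apply: filterS (hQ _ P0) => t Qt [|k].
    by apply: nearW => t [|k] //; rewrite (negPf P0).
  have [P0|P0] := boolP (P n.+1).
    apply: filterS2 IH (hQ _ P0) => t h1 h2 k.
    by rewrite leq_eqVlt => /orP[/eqP ->//|]; exact: h1.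
  apply: filterS IH => t h1 k; rewrite leq_eqVlt => /orP[/eqP ->|]; last exact: h1.
  by rewrite (negPf P0).
by apply: filterS => t h1 k Pk; apply: h1 => //; exact: Pn.
Qed.

Lemma near_and (P Q : T -> Prop) : (\forall t \near F, P t) -> (\forall t \near F, Q t) ->
  \forall t \near F, P t /\ Q t.
Proof. by move=> h1 h2; apply: filterS2 h1 h2. Qed.

Lemma near_and5 (P1 P2 P3 P4 P5 : T -> Prop) :
  (\forall t \near F, P1 t) -> (\forall t \near F, P2 t) -> (\forall t \near F, P3 t) ->
  (\forall t \near F, P4 t) -> (\forall t \near F, P5 t) ->
  \forall t \near F, [/\ P1 t, P2 t, P3 t, P4 t & P5 t].
Proof.
move=> h1 h2 h3 h4 h5.
by apply: filterS2 (near_and (near_and h1 h2) (near_and h3 h4)) h5 => t [[? ?] [? ?]].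
Qed.

Ltac cls := solve_classes H.
Let nd z := near_num_den H hl ha hb (z := z).
Let nn z := near_num H hl ha hb (z := z).
Let nds s z := near_num_den_sh H hl ha hb (s := s) (z := z).
Let ns s z := near_num_sh H hl ha hb (s := s) (z := z).
Let wd s z := near_weight_den_sh H hl ha hb (s := s) (z := z).
Let ww s z := near_weight_sh H hl ha hb (s := s) (z := z).

Let common : ell_num_den (l t0) p (a t0) (b t0) (2 * c t0 * d t0) != 0 /\
    ell_num (l t0) p (a t0) (b t0) (2 * c t0 * d t0) != 0 ->
  ell_num_den_sh (l t0) p (a t0) (b t0) ((c t0 - g t0) * d t0) (c t0 * h t0 + d t0 * g t0) != 0 /\
    ell_num_sh (l t0) p (a t0) (b t0) ((c t0 - g t0) * d t0) (c t0 * h t0 + d t0 * g t0) != 0 ->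
  \forall t \near F, (a t != 0 /\ b t != 0) /\
  ((ell_num_den (l t) p (a t) (b t) (2 * c t * d t) != 0 /\
    ell_num (l t) p (a t) (b t) (2 * c t * d t) != 0) /\
  (ell_num_den_sh (l t) p (a t) (b t) ((c t - g t) * d t) (c t * h t + d t * g t) != 0 /\
    ell_num_sh (l t) p (a t) (b t) ((c t - g t) * d t) (c t * h t + d t * g t) != 0)).
Proof.
move=> [h1 h2] [h3 h4]; apply: near_and.
  exact: near_and (ex_neq0 H ha) (ex_neq0 H hb).
apply: near_and; apply: near_and.
- exact: (nd (z := fun t => 2 * c t * d t) ltac:(cls) h1).
- exact: (nn (z := fun t => 2 * c t * d t) ltac:(cls) h2).
- exact: (nds (s := fun t => (c t - g t) * d t) (z := fun t => c t * h t + d t * g t)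
    ltac:(cls) ltac:(cls) h3).
- exact: (ns (s := fun t => (c t - g t) * d t) (z := fun t => c t * h t + d t * g t)
    ltac:(cls) ltac:(cls) h4).
Qed.

Lemma near_lhs_regular n : lhs_regular p n (pt t0) -> \forall t \near F, lhs_regular p n (pt t).
Proof.
move=> [_ h1 h2 hk hj].
have qk := @near_forall_le (fun k t =>
  ell_num_den (l t) p (a t) (b t) (2 * (g t * k%:R + c t) * (h t * k%:R + d t)) != 0 /\
  ell_num_den_sh (l t) p (a t) (b t) ((g t * k%:R - g t + c t) * (h t * k%:R + d t))
    (2 * g t * h t * k%:R + c t * h t + d t * g t) != 0)
  (fun k => k <= n)%N n (fun k kn => kn).
have {}qk := qk ltac:(move=> k kn; have [k1 k2] := hk k kn; exact: near_and
  (nd (z := fun t => 2 * (g t * k%:R + c t) * (h t * k%:R + d t)) ltac:(cls) k1)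
  (nds (s := fun t => (g t * k%:R - g t + c t) * (h t * k%:R + d t))
     (z := fun t => 2 * g t * h t * k%:R + c t * h t + d t * g t)
     ltac:(cls) ltac:(cls) k2)).
have qj := @near_forall_le (fun j t => [/\
  ell_num_den_sh (l t) p (a t) (b t) ((g t * j%:R - g t + c t) * (h t * j%:R + d t))
    ((g t * j%:R + g t + c t) * (h t * j%:R + d t)) != 0,
  ell_num_den_sh (l t) p (a t) (b t) ((g t * j%:R + g t + c t) * (h t * j%:R + 2 * h t + d t))
    ((g t * j%:R + g t + c t) * (h t * j%:R + d t)) != 0,
  ell_num_sh (l t) p (a t) (b t) ((g t * j%:R + g t + c t) * (h t * j%:R + 2 * h t + d t))
    ((g t * j%:R + g t + c t) * (h t * j%:R + d t)) != 0,
  ell_weight_den_sh (l t) p (a t) (b t) ((g t * j%:R + c t) * (h t * j%:R + h t + d t))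
    (2 * g t * h t * j%:R + 2 * g t * h t + c t * h t + d t * g t) != 0 &
  ell_weight_sh (l t) p (a t) (b t) ((g t * j%:R + c t) * (h t * j%:R + h t + d t))
    (2 * g t * h t * j%:R + 2 * g t * h t + c t * h t + d t * g t) != 0])
  (fun j => j < n)%N n (fun j jn => ltnW jn).
have {}qj := qj ltac:(move=> j jn; have [j1 j2 j3 j4 j5] := hj j jn; exact: near_and5
  (nds (s := fun t => (g t * j%:R - g t + c t) * (h t * j%:R + d t))
     (z := fun t => (g t * j%:R + g t + c t) * (h t * j%:R + d t)) ltac:(cls) ltac:(cls) j1)
  (nds (s := fun t => (g t * j%:R + g t + c t) * (h t * j%:R + 2 * h t + d t))
     (z := fun t => (g t * j%:R + g t + c t) * (h t * j%:R + d t)) ltac:(cls) ltac:(cls) j2)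
  (ns (s := fun t => (g t * j%:R + g t + c t) * (h t * j%:R + 2 * h t + d t))
     (z := fun t => (g t * j%:R + g t + c t) * (h t * j%:R + d t)) ltac:(cls) ltac:(cls) j3)
  (wd (s := fun t => (g t * j%:R + c t) * (h t * j%:R + h t + d t))
     (z := fun t => 2 * g t * h t * j%:R + 2 * g t * h t + c t * h t + d t * g t)
     ltac:(cls) ltac:(cls) j4)
  (ww (s := fun t => (g t * j%:R + c t) * (h t * j%:R + h t + d t))
     (z := fun t => 2 * g t * h t * j%:R + 2 * g t * h t + c t * h t + d t * g t)
     ltac:(cls) ltac:(cls) j5)).
by apply: filterS3 (common h1 h2) qk qj => t [r1 [r2 r3]] r4 r5; split.
Qed.

Lemma near_rhs_regular n : rhs_regular p n (pt t0) -> \forall t \near F, rhs_regular p n (pt t).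
Proof.
move=> [[_ _ h3 h4] h1 h2 [h5 h6 h7] hj].
have q1 := near_and
  (nd (z := fun t => (g t * n%:R + c t) * (h t * n%:R + h t + d t)) ltac:(cls) h3)
  (nds (s := fun t => (c t - g t) * d t) (z := fun t => (g t + c t) * d t)
    ltac:(cls) ltac:(cls) h4).
have q2 := near_and (nd (z := fun t => (c t - g t) * d t) ltac:(cls) h5) (near_and
  (nds (s := fun t => c t * (h t + d t)) (z := fun t => c t * (d t - h t))
    ltac:(cls) ltac:(cls) h6)
  (wd (s := fun t => (c t - g t) * d t) (z := fun t => c t * h t + d t * g t)
    ltac:(cls) ltac:(cls) h7)).
have qj := @near_forall_le (fun j t => [/\
  ell_num_den_sh (l t) p (a t) (b t) ((g t * j%:R - g t + c t) * (h t * j%:R + d t))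
    ((g t * j%:R + g t + c t) * (h t * j%:R + d t)) != 0,
  ell_num_den_sh (l t) p (a t) (b t) ((g t * j%:R + c t) * (h t * j%:R + h t + d t))
    ((g t * j%:R + c t) * (h t * j%:R - h t + d t)) != 0,
  ell_num_sh (l t) p (a t) (b t) ((g t * j%:R + c t) * (h t * j%:R + h t + d t))
    ((g t * j%:R + c t) * (h t * j%:R - h t + d t)) != 0,
  ell_weight_den_sh (l t) p (a t) (b t) ((g t * j%:R - g t + c t) * (h t * j%:R + d t))
    (2 * g t * h t * j%:R + c t * h t + d t * g t) != 0 &
  ell_weight_sh (l t) p (a t) (b t) ((g t * j%:R - g t + c t) * (h t * j%:R + d t))
    (2 * g t * h t * j%:R + c t * h t + d t * g t) != 0])
  (fun j => 1 <= j <= n)%N n (fun j jn => proj2 (andP jn)).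
have {}qj := qj ltac:(move=> j jn; have [j1 j2 j3 j4 j5] := hj j jn; exact: near_and5
  (nds (s := fun t => (g t * j%:R - g t + c t) * (h t * j%:R + d t))
     (z := fun t => (g t * j%:R + g t + c t) * (h t * j%:R + d t)) ltac:(cls) ltac:(cls) j1)
  (nds (s := fun t => (g t * j%:R + c t) * (h t * j%:R + h t + d t))
     (z := fun t => (g t * j%:R + c t) * (h t * j%:R - h t + d t)) ltac:(cls) ltac:(cls) j2)
  (ns (s := fun t => (g t * j%:R + c t) * (h t * j%:R + h t + d t))
     (z := fun t => (g t * j%:R + c t) * (h t * j%:R - h t + d t)) ltac:(cls) ltac:(cls) j3)
  (wd (s := fun t => (g t * j%:R - g t + c t) * (h t * j%:R + d t))
     (z := fun t => 2 * g t * h t * j%:R + c t * h t + d t * g t)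
     ltac:(cls) ltac:(cls) j4)
  (ww (s := fun t => (g t * j%:R - g t + c t) * (h t * j%:R + d t))
     (z := fun t => 2 * g t * h t * j%:R + c t * h t + d t * g t)
     ltac:(cls) ltac:(cls) j5)).
apply: filterS3 (near_and (common h1 h2) q1) q2 qj => t.
by move=> [[[a0 b0] [r1 r2]] [r3 r4]] [r5 [r6 r7]] r8; split.
Qed.

End PersistenceRegular.

(** * Continuity of both sides *)

Section ContinuousClasses.
Variables (R : realType) (T : Type) (F : set_system T).
Context {FF : Filter F}.
Local Notation C := (Cplx R).
Variables (p : C) (t0 : T).
Hypothesis hp : nrm p < 1.

Definition cvg_sc (f : T -> C) : Prop := f @ F --> f t0.
Definition cvg_nz (f : T -> C) : Prop := f t0 != 0 /\ f @ F --> f t0.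

Lemma cvg_neq0 (f : T -> C) (l : C) : l != 0 -> f @ F --> l -> \forall t \near F, f t != 0.
Proof.
move=> l0 fl; have l1 : 0 < nrm l by rewrite nrm_gt0.
by apply: filterS (cvgr_gt _ (cvg_nrm fl) _ l1) => t; rewrite nrm_gt0.
Qed.

Lemma cvg_stable_classes : stable_classes F p t0 cvg_sc cvg_nz.
Proof.
rewrite /cvg_sc /cvg_nz; split.
- by move=> z; exact: cvg_cst.
- by move=> f g hf hg; exact: (cvgD hf hg).
- by move=> f hf; exact: (cvgN hf).
- by move=> f g hf hg; exact: (cvgM hf hg).
- by move=> f hf; split; [exact: cexp_neq0|exact: cvg_cexp].
- by move=> f g [f0 hf] [g0 hg]; split; [exact: mulf_neq0|exact: (cvgM hf hg)].
- by move=> f [f0 hf]; split; [rewrite invr_eq0|exact: (cvgV f0 hf)].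
- by move=> f [f0 hf]; exact: cvg_neq0 hf.
- by move=> f [f0 hf] h; apply: (cvg_neq0 h); exact: cvg_theta.
Qed.
Local Notation H := cvg_stable_classes.

Lemma cvg_thetas fs : all_ex cvg_nz fs ->
  thetas p [seq f t | f <- fs] @[t --> F] --> thetas p [seq f t0 | f <- fs].
Proof.
elim: fs => [_|f fs IH [hf hfs]].
  rewrite /thetas /=; under eq_fun do rewrite big_nil. rewrite big_nil.
  exact: (@cvg_cst C 1 T F FF).
rewrite /thetas /=; under eq_fun do rewrite big_cons; rewrite big_cons.
by case: hf => f0 hf; exact: (cvgM (cvg_theta hp f0 hf) (IH hfs)).
Qed.

Section Atoms.
Variables (l a b : T -> C).
Hypotheses (hl : cvg_sc l) (ha : cvg_nz a) (hb : cvg_nz b).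

Lemma cvg_num z : cvg_sc z -> ell_num_den (l t0) p (a t0) (b t0) (z t0) != 0 ->
  cvg_sc (fun t => ell_num (l t) p (a t) (b t) (z t)).
Proof.
move=> hz d0; have hn := @cvg_thetas [:: fun t => qpow (l t) (z t);
  fun t => a t * qpow (l t) (z t); fun t => b t * cexp (l t) ^+ 2; fun t => a t / b t]
  ltac:(solve_classes H).
have hd := @cvg_thetas [:: fun t => cexp (l t);
  fun t => a t * cexp (l t); fun t => b t * qpow (l t) (z t + 1);
  fun t => a t * qpow (l t) (z t - 1) / b t] ltac:(solve_classes H).
exact: cvgM hn (cvgV d0 hd).
Qed.

Lemma cvg_weight z : cvg_sc z -> ell_weight_den (l t0) p (a t0) (b t0) (z t0) != 0 ->
  cvg_sc (fun t => ell_weight (l t) p (a t) (b t) (z t)).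
Proof.
move=> hz d0; have hn := @cvg_thetas [:: fun t => a t * qpow (l t) (2 * z t + 1);
  fun t => b t * cexp (l t); fun t => b t * cexp (l t) ^+ 2;
  fun t => a t * (cexp (l t))^-1 / b t; fun t => a t / b t]
  ltac:(solve_classes H).
have hd := @cvg_thetas [:: fun t => a t * cexp (l t);
  fun t => b t * qpow (l t) (z t + 1); fun t => b t * qpow (l t) (z t + 2);
  fun t => a t * qpow (l t) (z t - 1) / b t; fun t => a t * qpow (l t) (z t) / b t]
  ltac:(solve_classes H).
have hq : cvg_sc (fun t => qpow (l t) (z t)).
  by have [] : cvg_nz (fun t => qpow (l t) (z t)) by solve_classes H.
exact: cvgM (cvgM hn (cvgV d0 hd)) hq.
Qed.

End Atoms.

Variables (a b l c d g h : T -> C).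
Hypotheses (ha : cvg_nz a) (hb : cvg_nz b) (hl : cvg_sc l) (hc : cvg_sc c) (hd : cvg_sc d)
  (hg : cvg_sc g) (hh : cvg_sc h).
Local Notation pt t := (a t, b t, l t, c t, d t, g t, h t).

Lemma cvg_num_sh s z : cvg_sc s -> cvg_sc z ->
  ell_num_den_sh (l t0) p (a t0) (b t0) (s t0) (z t0) != 0 ->
  cvg_sc (fun t => ell_num_sh (l t) p (a t) (b t) (s t) (z t)).
Proof.
rewrite /ell_num_den_sh /ell_num_sh => hs hz.
exact: (@cvg_num l (fun t => a t * qpow (l t) (2 * s t)) (fun t => b t * qpow (l t) (s t))
  hl ltac:(solve_classes H) ltac:(solve_classes H) z hz).
Qed.

Lemma cvg_weight_sh s z : cvg_sc s -> cvg_sc z ->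
  ell_weight_den_sh (l t0) p (a t0) (b t0) (s t0) (z t0) != 0 ->
  cvg_sc (fun t => ell_weight_sh (l t) p (a t) (b t) (s t) (z t)).
Proof.
rewrite /ell_weight_den_sh /ell_weight_sh => hs hz.
exact: (@cvg_weight l (fun t => a t * qpow (l t) (2 * s t)) (fun t => b t * qpow (l t) (s t))
  hl ltac:(solve_classes H) ltac:(solve_classes H) z hz).
Qed.

Lemma cvg_sc_div f k : cvg_sc f -> cvg_sc k -> k t0 != 0 -> cvg_sc (fun t => f t / k t).
Proof. by rewrite /cvg_sc => hf hk k0; exact: (cvgM hf (cvgV k0 hk)). Qed.

Lemma cvg_sc_inv k : cvg_sc k -> k t0 != 0 -> cvg_sc (fun t => (k t)^-1).
Proof. by rewrite /cvg_sc => hk k0; exact: (cvgV k0 hk). Qed.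

Lemma cvg_sc_sum m n (f : nat -> T -> C) : (forall k, (m <= k < n)%N -> cvg_sc (f k)) ->
  cvg_sc (fun t => \sum_(m <= k < n) f k t).
Proof.
move=> hf; have {hf} : forall k, k \in index_iota m n -> cvg_sc (f k).
  by move=> k; rewrite mem_index_iota; exact: hf.
elim: (index_iota m n) => [|k r IH] hf.
  rewrite [X in cvg_sc X](_ : _ = fun=> 0); first exact: (sc_cst H 0).
  by apply/funext => t; rewrite big_nil.
rewrite [X in cvg_sc X](_ : _ = fun t => f k t + \sum_(k <- r) f k t); last first.
  by apply/funext => t; rewrite big_cons.
apply: (sc_add H); first by apply: hf; exact: mem_head.
by apply: IH => i ir; apply: hf; rewrite in_cons ir orbT.
Qed.

Lemma cvg_sc_prod m n (f : nat -> T -> C) : (forall k, (m <= k < n)%N -> cvg_sc (f k)) ->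
  cvg_sc (fun t => \prod_(m <= k < n) f k t).
Proof.
move=> hf; have {hf} : forall k, k \in index_iota m n -> cvg_sc (f k).
  by move=> k; rewrite mem_index_iota; exact: hf.
elim: (index_iota m n) => [|k r IH] hf.
  rewrite [X in cvg_sc X](_ : _ = fun=> 1); first exact: (sc_cst H 1).
  by apply/funext => t; rewrite big_nil.
rewrite [X in cvg_sc X](_ : _ = fun t => f k t * \prod_(k <- r) f k t); last first.
  by apply/funext => t; rewrite big_cons.
apply: (sc_mul H); first by apply: hf; exact: mem_head.
by apply: IH => i ir; apply: hf; rewrite in_cons ir orbT.
Qed.

Ltac cls := solve_classes H.
Let cn z := cvg_num hl ha hb (z := z).
Let cns s z := cvg_num_sh (s := s) (z := z).
Let cw s z := cvg_weight_sh (s := s) (z := z).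

Lemma cvg_lhs n : lhs_regular p n (pt t0) -> cvg_sc (fun t => lhs p n (pt t)).
Proof.
move=> [_ [h1 h2] [h3 h4] hk hj].
have q1 := cn (z := fun t => 2 * c t * d t) ltac:(cls) h1.
have q2 := cns (s := fun t => (c t - g t) * d t) (z := fun t => c t * h t + d t * g t)
  ltac:(cls) ltac:(cls) h3.
apply: cvg_sc_sum => k kn; have {hk} [k1 k2] := hk k kn.
apply: (sc_mul H); last first.
  apply: cvg_sc_prod => j jk; have [_ _ _ j4 j5] := hj j (leq_trans jk kn).
  apply: cvg_sc_inv; last exact: j5.
  exact: (cw (s := fun t => (g t * j%:R + c t) * (h t * j%:R + h t + d t))
    (z := fun t => 2 * g t * h t * j%:R + 2 * g t * h t + c t * h t + d t * g t)
    ltac:(cls) ltac:(cls) j4).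
apply: (sc_mul H); last first.
  apply: cvg_sc_prod => j jk; have [j1 j2 j3 _ _] := hj j (leq_trans jk kn).
  apply: cvg_sc_div; last exact: j3.
    exact: (cns (s := fun t => (g t * j%:R - g t + c t) * (h t * j%:R + d t))
      (z := fun t => (g t * j%:R + g t + c t) * (h t * j%:R + d t)) ltac:(cls) ltac:(cls) j1).
  exact: (cns (s := fun t => (g t * j%:R + g t + c t) * (h t * j%:R + 2 * h t + d t))
    (z := fun t => (g t * j%:R + g t + c t) * (h t * j%:R + d t)) ltac:(cls) ltac:(cls) j2).
apply: cvg_sc_div; last exact: mulf_neq0 h2 h4.
  apply: (sc_mul H).
    exact: (cn (z := fun t => 2 * (g t * k%:R + c t) * (h t * k%:R + d t)) ltac:(cls) k1).
  exact: (cns (s := fun t => (g t * k%:R - g t + c t) * (h t * k%:R + d t))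
     (z := fun t => 2 * g t * h t * k%:R + c t * h t + d t * g t)
     ltac:(cls) ltac:(cls) k2).
exact: (sc_mul H q1 q2).
Qed.

Lemma cvg_rhs n : rhs_regular p n (pt t0) -> cvg_sc (fun t => rhs p n (pt t)).
Proof.
move=> [[_ _ h3 h4] [h1 h2] [h5 h6] [h7 h8 h9] hj].
have q1 := cn (z := fun t => 2 * c t * d t) ltac:(cls) h1.
have q2 := cns (s := fun t => (c t - g t) * d t) (z := fun t => c t * h t + d t * g t)
  ltac:(cls) ltac:(cls) h5.
have q12 := sc_mul H q1 q2.
apply: (sc_add H); last first.
  apply: (sc_opp H); apply: (sc_mul H); last first.
    exact: (cw (s := fun t => (c t - g t) * d t) (z := fun t => c t * h t + d t * g t)
      ltac:(cls) ltac:(cls) h9).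
  apply: cvg_sc_div; [|exact: q12|exact: mulf_neq0 h2 h6].
  apply: (sc_mul H); first exact: (cn (z := fun t => (c t - g t) * d t) ltac:(cls) h7).
  exact: (cns (s := fun t => c t * (h t + d t)) (z := fun t => c t * (d t - h t))
    ltac:(cls) ltac:(cls) h8).
apply: (sc_mul H); last first.
  apply: cvg_sc_prod => j jn; have [_ _ _ j4 j5] := hj j jn.
  apply: cvg_sc_inv; last exact: j5.
  exact: (cw (s := fun t => (g t * j%:R - g t + c t) * (h t * j%:R + d t))
     (z := fun t => 2 * g t * h t * j%:R + c t * h t + d t * g t)
     ltac:(cls) ltac:(cls) j4).
apply: (sc_mul H); last first.
  apply: cvg_sc_prod => j jn; have [j1 j2 j3 _ _] := hj j jn.
  apply: cvg_sc_div; last exact: j3.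
    exact: (cns (s := fun t => (g t * j%:R - g t + c t) * (h t * j%:R + d t))
      (z := fun t => (g t * j%:R + g t + c t) * (h t * j%:R + d t)) ltac:(cls) ltac:(cls) j1).
  exact: (cns (s := fun t => (g t * j%:R + c t) * (h t * j%:R + h t + d t))
     (z := fun t => (g t * j%:R + c t) * (h t * j%:R - h t + d t)) ltac:(cls) ltac:(cls) j2).
apply: cvg_sc_div; [|exact: q12|exact: mulf_neq0 h2 h6].
apply: (sc_mul H).
  exact: (cn (z := fun t => (g t * n%:R + c t) * (h t * n%:R + h t + d t)) ltac:(cls) h3).
exact: (cns (s := fun t => (c t - g t) * d t) (z := fun t => (g t + c t) * d t)
    ltac:(cls) ltac:(cls) h4).
Qed.

End ContinuousClasses.

(** * Regularity along real lines *)

Section Cocountable.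
Variables (R : realType).
Local Notation C := (Cplx R).

Lemma countable_setU (T : Type) (A B : set T) :
  countable A -> countable B -> countable (A `|` B).
Proof.
move=> hA hB; rewrite [_ `|` _](_ : _ = \bigcup_(i in [set: bool]) (if i then A else B)).
  by apply: bigcup_countable => // -[].
apply/seteqP; split => t; first by move=> [?|?]; [exists true|exists false].
by move=> [[] _ ?]; [left|right].
Qed.

(** Countable exceptional sets are the natural size here: an equation exp(P(t)) = w contributes one
    finite root set for each branch of the logarithm. *)
Definition cocountable : set_system R := [set A | countable (~` A)].

Global Instance cocountable_filter : Filter cocountable.
Proof.
split.
- by rewrite /cocountable /= setCT; exact: countable0.
- by move=> A B hA hB; rewrite /cocountable /= setCI; apply: countable_setU.
- by move=> A B AB; apply: sub_countable; apply: subset_card_le; exact: subsetC.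
Qed.

(** Along a line, exponents such as s log q are products of several affine functions of t;
    polynomials are closed under such products. *)
Definition poly_sc (f : R -> C) : Prop := exists P : {poly C}, forall t, f t = P.[t%:C%C].
Definition poly_ex (f : R -> C) : Prop :=
  exists P : {poly C}, forall t, f t = cexp P.[t%:C%C].

Lemma countable_root (P : {poly C}) : P != 0 -> countable [set t : R | P.[t%:C%C] = 0].
Proof.
move=> P0; have [r Pr] := closed_field_poly_normal P.
apply: finite_set_countable.
apply: (@sub_finite_set _ _ [set` [seq complex.Re z | z <- r]]); last exact: finite_seq.
move=> t /= /rootP; rewrite Pr rootZ ?lead_coef_eq0// root_prod_XsubC => tr.
by apply/mapP; exists t%:C%C.
Qed.

(** Fix one solution t1. Any other t has P(t) - P(t1) = 2 pi i m for an integer m, and for each m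
    this is a nonzero polynomial equation because P is not constant. *)
Lemma countable_cexp_level (P : {poly C}) (w : C) : (1 < size P)%N ->
  countable [set t : R | cexp P.[t%:C%C] = w].
Proof.
move=> P1; have [->|/set0P[t1 /= ht1]] := eqVneq [set t : R | cexp P.[t%:C%C] = w] set0.
  exact: countable0.
pose Q (m : int) := P - (P.[t1%:C%C] + cpi2 R *~ m)%:P.
have Q0 m : Q m != 0.
  rewrite subr_eq0; apply/eqP => E; move: P1; rewrite E => /leq_trans/(_ (size_polyC_leq1 _)).
  by rewrite ltnn.
apply: (@sub_countable _ _ _ (\bigcup_(m in [set: int]) [set t : R | (Q m).[t%:C%C] = 0])).
  apply: subset_card_le => t /= ht.
  have /cexp_eq1 [m hm] : cexp (P.[t%:C%C] - P.[t1%:C%C]) = 1.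
    by rewrite cexpD cexpN ht ht1 divff// -ht1 cexp_neq0.
  by exists m => //=; rewrite /Q !hornerE -hm; ring.
by apply: bigcup_countable => // m _; exact: countable_root.
Qed.

Variables (p : C).
Hypothesis hp : nrm p < 1.

Lemma poly_stable_classes (t0 : R) : stable_classes cocountable p t0 poly_sc poly_ex.
Proof.
split.
- by move=> z; exists z%:P => t; rewrite hornerC.
- by move=> f g [P hP] [Q hQ]; exists (P + Q) => t; rewrite hP hQ hornerD.
- by move=> f [P hP]; exists (- P) => t; rewrite hP hornerN.
- by move=> f g [P hP] [Q hQ]; exists (P * Q) => t; rewrite hP hQ hornerM.
- by move=> f [P hP]; exists P => t; rewrite hP.
- by move=> f g [P hP] [Q hQ]; exists (P + Q) => t; rewrite hP hQ hornerD cexpD.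
- by move=> f [P hP]; exists (- P) => t; rewrite hP hornerN cexpN.
- by move=> f [P hP]; apply: nearW => t; rewrite hP cexp_neq0.
(* With a constant exponent theta is constant along the line, and its nonvanishing is inherited from
   t0. *)
move=> f [P hP] h0; have [P1|P1] := leqP (size P) 1.
  apply: nearW => t; move: h0; rewrite !hP; have -> : P = (P`_0)%:P by exact: size1_polyC.
  by rewrite !hornerC.
(* By [theta_neq0], theta vanishes at a nonzero argument only if one of its factors does, that is at
   p^(-j) or p^(j+1). *)
apply: (@sub_countable _ _ _ (\bigcup_(j in [set: nat])
    ([set t : R | cexp P.[t%:C%C] = (p ^+ j)^-1] `|`
     [set t : R | cexp P.[t%:C%C] = p ^+ j.+1]))).
  apply: subset_card_le => t /= /negP; rewrite negbK => /eqP ht.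
  apply: contrapT => hn; move/eqP: ht; apply/negP; apply: theta_neq0 => //.
  - by rewrite hP cexp_neq0.
  - move=> j; apply/eqP => E; apply: hn; exists j => //; left => /=.
    by rewrite -hP; apply/esym/mulr1_eq; rewrite mulrC.
  - move=> j; apply/eqP => E; apply: hn; exists j => //; right => /=.
    by rewrite -hP; apply/esym/divr1_eq.
by apply: bigcup_countable => // j _; apply: countable_setU; exact: countable_cexp_level.
Qed.

(** Otherwise some interval ]0, e[ would be countable, hence of Lebesgue measure 0. *)
Lemma cocountable_proper_near0 (A U : set R) : cocountable A -> nbhs 0 U -> exists t, A t /\ U t.
Proof.
move=> cA /nbhs_ballP[e /= e0 eU]; apply: contrapT => hn.
have : countable [set` `]0, e[%R].
  apply: sub_countable cA; apply: subset_card_le => t /=; rewrite in_itv/= => /andP[t0 te] At.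
  apply: hn; exists t; split => //; apply: eU.
  by rewrite /ball/= sub0r normrN gtr0_norm.
move/countable_lebesgue_measure0; rewrite lebesgue_measure_itv/= lte_fin e0 => /eqP.
by rewrite -EFinD eqe subr0 gt_eqF.
Qed.

End Cocountable.

(** * Removable singularities *)

Section RegularPoints.
Variables (R : realType).
Local Notation C := (Cplx R).
Variables (p : C) (n : nat).
Hypothesis hp : nrm p < 1.

Lemma cvg_coord (z : params R) :
  [/\ cvg_sc (nbhs z) z (fun t : params R => t.1.1.1.1.1.1),
      cvg_sc (nbhs z) z (fun t : params R => t.1.1.1.1.1.2),
      cvg_sc (nbhs z) z (fun t : params R => t.1.1.1.1.2) &
      cvg_sc (nbhs z) z (fun t : params R => t.1.1.1.2) /\
      cvg_sc (nbhs z) z (fun t : params R => t.1.1.2) /\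
      cvg_sc (nbhs z) z (fun t : params R => t.1.2) /\
      cvg_sc (nbhs z) z (fun t : params R => t.2)].
Proof.
rewrite /cvg_sc; case: z => [[[[[[a b] l] c] d] g] h].
have fstc (U V : topologicalType) (F : set_system (params R)) (FF : Filter F)
  (f : params R -> U * V) (u : U) (v : V) : f @ F --> (u, v) -> (f t).1 @[t --> F] --> u.
  by move=> hf; exact: (cvg_comp _ _ hf cvg_fst).
have sndc (U V : topologicalType) (F : set_system (params R)) (FF : Filter F)
  (f : params R -> U * V) (u : U) (v : V) : f @ F --> (u, v) -> (f t).2 @[t --> F] --> v.
  by move=> hf; exact: (cvg_comp _ _ hf cvg_snd).
set z : params R := (a, b, l, c, d, g, h).
have FF := nbhs_filter z.
have h0 : id @ nbhs z --> z by exact: cvg_id.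
have h1 := fstc _ _ _ FF _ _ _ h0; have h2 := fstc _ _ _ FF _ _ _ h1.
have h3 := fstc _ _ _ FF _ _ _ h2; have h4 := fstc _ _ _ FF _ _ _ h3.
have h5 := fstc _ _ _ FF _ _ _ h4; have h6 := fstc _ _ _ FF _ _ _ h5.
split; [exact: h6|exact: (sndc _ _ _ FF _ _ _ h5)|exact: (sndc _ _ _ FF _ _ _ h4)|].
split; first exact: (sndc _ _ _ FF _ _ _ h3).
split; first exact: (sndc _ _ _ FF _ _ _ h2).
split; first exact: (sndc _ _ _ FF _ _ _ h1).
exact: (sndc _ _ _ FF _ _ _ h0).
Qed.

Let cvg_coords (z : params R) : z.1.1.1.1.1.1 != 0 -> z.1.1.1.1.1.2 != 0 ->
  [/\ cvg_nz (nbhs z) z (fun t : params R => t.1.1.1.1.1.1),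
      cvg_nz (nbhs z) z (fun t : params R => t.1.1.1.1.1.2),
      cvg_sc (nbhs z) z (fun t : params R => t.1.1.1.1.2) &
      cvg_sc (nbhs z) z (fun t : params R => t.1.1.1.2) /\
      cvg_sc (nbhs z) z (fun t : params R => t.1.1.2) /\
      cvg_sc (nbhs z) z (fun t : params R => t.1.2) /\
      cvg_sc (nbhs z) z (fun t : params R => t.2)].
Proof.
move=> a0 b0; have [h1 h2 h3 h4] := cvg_coord z.
split; [exact: conj a0 h1|exact: conj b0 h2|exact: h3|exact: h4].
Qed.

Let params_eta (t : params R) :
  (t.1.1.1.1.1.1, t.1.1.1.1.1.2, t.1.1.1.1.2, t.1.1.1.2, t.1.1.2, t.1.2, t.2) = t.
Proof. by case: t => [[[[[[? ?] ?] ?] ?] ?] ?]. Qed.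

Lemma nbhs_lhs_regular z : lhs_regular p n z -> \forall t \near z, lhs_regular p n t.
Proof.
move=> hz; have [a0 b0] : z.1.1.1.1.1.1 != 0 /\ z.1.1.1.1.1.2 != 0.
  by move: hz; case: z => [[[[[[a b] l] c] d] g] h] [].
have [ha hb hl [hc [hd [hg hh]]]] := cvg_coords a0 b0.
have K := cvg_stable_classes z hp (FF := nbhs_filter z).
rewrite -(params_eta z) in hz.
have := near_lhs_regular (FF := nbhs_filter z) K ha hb hl hc hd hg hh hz.
by apply: (@filterS _ _ (nbhs_filter z)) => t; rewrite params_eta.
Qed.

Lemma cvg_lhs_nbhs z : lhs_regular p n z -> lhs p n t @[t --> z] --> lhs p n z.
Proof.
move=> hz; have [a0 b0] : z.1.1.1.1.1.1 != 0 /\ z.1.1.1.1.1.2 != 0.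
  by move: hz; case: z => [[[[[[a b] l] c] d] g] h] [].
have [ha hb hl [hc [hd [hg hh]]]] := cvg_coords a0 b0.
rewrite -(params_eta z) in hz.
have := cvg_lhs (FF := nbhs_filter z) hp ha hb hl hc hd hg hh hz; rewrite /cvg_sc params_eta.
by under eq_fun do rewrite params_eta.
Qed.

Lemma cvg_rhs_nbhs z : rhs_regular p n z -> rhs p n t @[t --> z] --> rhs p n z.
Proof.
move=> hz; have [a0 b0] : z.1.1.1.1.1.1 != 0 /\ z.1.1.1.1.1.2 != 0.
  by move: hz; case: z => [[[[[[a b] l] c] d] g] h] [[]].
have [ha hb hl [hc [hd [hg hh]]]] := cvg_coords a0 b0.
rewrite -(params_eta z) in hz.
have := cvg_rhs (FF := nbhs_filter z) hp ha hb hl hc hd hg hh hz; rewrite /cvg_sc params_eta.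
by under eq_fun do rewrite params_eta.
Qed.

Lemma poly_sc_line (z w : C) : poly_sc (fun t : R => z + t%:C%C * (w - z)).
Proof.
by exists (z%:P + 'X * (w - z)%:P) => t; rewrite !hornerE.
Qed.

Lemma cvg_line (z w : C) : z + t%:C%C * (w - z) @[t --> (0 : R)] --> z.
Proof.
have h : (t%:C%C : C) @[t --> (0 : R)] --> (0 : C).
  by apply: cvg_ReIm => /=; [exact: cvg_id|exact: cvg_cst].
have e : z + 0 * (w - z) = z by rewrite mul0r addr0.
rewrite -[X in _ --> X]e; apply: cvgD; first exact: cvg_cst.
by apply: cvgM; [exact: h|exact: cvg_cst].
Qed.

Lemma cvg_tuple (T : Type) (F : set_system T) (FF : Filter F) (U V : topologicalType)
    (f : T -> U) (k : T -> V) (u : U) (v : V) :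
  f @ F --> u -> k @ F --> v -> (f t, k t) @[t --> F] --> (u, v).
Proof. by move=> fu kv; exact: (cvg_pair fu kv). Qed.

(** The line runs from z at t = 0 to the regular point x at t = 1, whose regularity spreads to
    cocountably many t, some of them close to 0. The coordinates a and b move through their
    logarithms, which keeps them nonzero and makes all theta arguments exponentials of
    polynomials. *)
Lemma rhs_regular_dense (x z : params R) (U : set (params R)) : rhs_regular p n x ->
  z.1.1.1.1.1.1 != 0 -> z.1.1.1.1.1.2 != 0 -> nbhs z U -> exists y, U y /\ rhs_regular p n y.
Proof.
case: x z => [[[[[[a1 b1] l1] c1] d1] g1] h1] [[[[[[a b] l] c] d] g] h] /= hx a0 b0 zU.
have [a10 b10] : a1 != 0 /\ b1 != 0 by case: hx => [[]].
have [al eal] := cexp_surj a0; have [be ebe] := cexp_surj b0.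
have [al1 eal1] := cexp_surj a10; have [be1 ebe1] := cexp_surj b10.
pose L (u v : C) (t : R) := u + t%:C%C * (v - u).
have L1 u v : L u v 1 = v by rewrite /L mul1r addrC subrK.
have K := poly_stable_classes hp 1.
have hL u v : poly_sc (L u v) by exact: poly_sc_line.
have := near_rhs_regular (FF := @cocountable_filter R) K
  (ex_exp K (hL al al1)) (ex_exp K (hL be be1)) (hL l l1)
  (hL c c1) (hL d d1) (hL g g1) (hL h h1) (n := n).
rewrite !L1 eal1 ebe1 => /(_ hx) hreg.
have cL u v : L u v t @[t --> (0 : R)] --> u by exact: cvg_line.
have ca : cexp (L al al1 t) @[t --> (0 : R)] --> a by rewrite -eal; exact: (cvg_cexp (cL al al1)).
have cb : cexp (L be be1 t) @[t --> (0 : R)] --> b by rewrite -ebe; exact: (cvg_cexp (cL be be1)).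
have cU : (cexp (L al al1 t), cexp (L be be1 t), L l l1 t, L c c1 t, L d d1 t, L g g1 t,
    L h h1 t) @[t --> (0 : R)] --> ((a, b, l, c, d, g, h) : params R).
  have T := cvg_tuple (nbhs_filter (0 : R)).
  exact: (T _ _ _ _ _ _ (T _ _ _ _ _ _ (T _ _ _ _ _ _ (T _ _ _ _ _ _ (T _ _ _ _ _ _
    (T _ _ _ _ _ _ ca cb) (cL l l1)) (cL c c1)) (cL d d1)) (cL g g1)) (cL h h1)).
have [t [ht Ut]] := cocountable_proper_near0 hreg (cU _ zU).
by exists (cexp (L al al1 t), cexp (L be be1 t), L l l1 t, L c c1 t, L d d1 t, L g g1 t, L h h1 t).
Qed.

Lemma closure_regular z : closure (lhs_regular p n) z -> closure (rhs_regular p n) z ->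
  closure (lhs_regular p n `&` rhs_regular p n) z.
Proof.
(* Passing to the interior makes U a neighbourhood of the left-regular point y too, so a
   right-regular point can be sought near y. *)
move=> cl cr U /nbhs_interior zU.
have [x [hx _]] := cr setT filterT.
have [y [hy Uy]] := cl _ zU.
have [a0 b0] : y.1.1.1.1.1.1 != 0 /\ y.1.1.1.1.1.2 != 0.
  by move: hy; case: (y) => [[[[[[a b] l] c] d] g] h] [].
have [w [[hw Uw] hw']] := rhs_regular_dense hx a0 b0 (filterI (nbhs_lhs_regular hy) Uy).
by exists w.
Qed.

End RegularPoints.

Section ValueAt.
Variables (R : realType) (T : topologicalType).
Implicit Types (D : set T) (f : T -> Cplx R) (x : T).

Lemma makes_sense_closure D f x : makes_sense_at D f x -> closure D x.
Proof. by case=> [Dx|[]//]; exact: subset_closure. Qed.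

(** Unifies the two cases of [value_at]: at a regular point continuity makes the value a limit along
    D as well. *)
Lemma makes_sense_cvg D f x : (D x -> f @ x --> f x) -> makes_sense_at D f x ->
  f @ within D (nbhs x) --> value_at D f x.
Proof.
move=> fx hx; rewrite /value_at; case: asboolP => Dx.
  exact: cvg_trans (cvg_app _ (cvg_within _)) (fx Dx).
by case: hx => [/Dx []|[_ cf]]; exact: cf.
Qed.

End ValueAt.

Unset Implicit Arguments.

Theorem theorem1 (R : realType) (a b q p c d g h : Cplx R) (n : nat)
  (ha : a != 0) (hb : b != 0) (hq : q != 0) (hp : `|p| < 1)
  (logq : Cplx R) (hlogq : cexp logq = q)
  (hlhs : makes_sense_at (lhs_regular p n) (lhs p n) (a, b, logq, c, d, g, h))
  (hrhs : makes_sense_at (rhs_regular p n) (rhs p n) (a, b, logq, c, d, g, h)) :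
  value_at (lhs_regular p n) (lhs p n) (a, b, logq, c, d, g, h)
  = value_at (rhs_regular p n) (rhs p n) (a, b, logq, c, d, g, h).
Proof.
have {}hp : nrm p < 1 by rewrite -ltcR.
move: hlhs hrhs; set z : params R := (a, b, logq, c, d, g, h) => hl hr.
have cz := closure_regular hp (makes_sense_closure hl) (makes_sense_closure hr).
(* Properness, which says that common regular points accumulate at z, is what makes limits along the
   intersection unique. *)
have PF : ProperFilter (within (lhs_regular p n `&` rhs_regular p n) (nbhs z)).
  exact: within_nbhs_proper.
have cl := makes_sense_cvg (@cvg_lhs_nbhs R p n hp z) hl.
have cr := makes_sense_cvg (@cvg_rhs_nbhs R p n hp z) hr.
set I := lhs_regular p n `&` rhs_regular p n in PF.
have sl : within I (nbhs z) --> within (lhs_regular p n) (nbhs z).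
  by apply: within_subset => t [].
have sr : within I (nbhs z) --> within (rhs_regular p n) (nbhs z).
  by apply: within_subset => t [].
have {}cl := cvg_trans (cvg_app (lhs p n) sl) cl.
have {}cr := cvg_trans (cvg_app (rhs p n) sr) cr.
apply: (cvg_unique (@norm_hausdorff _ _) cl).
apply: cvg_trans cr; apply: near_eq_cvg; rewrite near_withinE; apply: nearW => t [h1 h2].
by rewrite lhs_eq_rhs.
Qed.
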